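(* Let $n$ and $d\ge 3$ be integers with $n\ge d+1$. Then $$\max_{G\in\mathcal{T}(n,d)}\mathsf{T}_{\mathsf{mix}}(G)=\mathsf{T}_{\mathsf{mix}}(D_{n,d}),$$ and the balanced double broom $D_{n,d}$ is the unique tree in $\mathcal{T}(n,d)$ attaining this maximum. Moreover, $$\mathsf{T}_{\mathsf{mix}}(D_{n,d})=\frac{(d-2)n-d+5}{2}-\frac{d^3-6d^2+8d}{6(n-1)}\quad\text{if } n-d \text{ is odd},$$ $$\mathsf{T}_{\mathsf{mix}}(D_{n,d})=\frac{(d-2)n-d+5}{2}-\frac{d^3-6d^2+11d-6}{6(n-1)}\quad\text{if } n-d \text{ is even}.$$
   Context: $\mathcal{T}(n,d)$ denotes the family of trees on $n$ vertices with diameter $d$. For a connected graph $G=(V,E)$, consider the simple (non-lazy) random walk, which moves from the current vertex $u$ to a uniformly random neighbour of $u$; its stationary distribution is $\pi_v=\deg(v)/(2|E|)$. For probability distributions $\sigma,\tau$ on $V$, a $(\sigma,\tau)$-stopping rule is a rule that halts a random walk whose initial vertex is drawn from $\sigma$ (the decision to stop may depend on the walk so far and on extra randomness) so that the final vertex has distribution $\tau$. The access time $H(\sigma,\tau)$ is the minimum expected number of steps over all $(\sigma,\tau)$-stopping rules; a vertex $v$ is identified with the point mass at $v$. The (exact) mixing time is $\mathsf{T}_{\mathsf{mix}}(G)=\max_{v\in V}H(v,\pi)$. A double broom in $\mathcal{T}(n,d)$ consists of a path $v_1,\dots,v_{d-1}$ together with $\ell\ge1$ pendant edges (leaves) attached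 at $v_1$ and $r\ge1$ pendant edges attached at $v_{d-1}$, so that $n=\ell+r+d-1$. The balanced double broom $D_{n,d}$ is the double broom with $\ell=\lceil (n-d+1)/2\rceil$ and $r=\lfloor (n-d+1)/2\rfloor$. *)

(* Defs.v *)
From mathcomp Require Import all_boot all_order all_algebra.
From mathcomp Require Import all_classical all_reals all_analysis.
Set Implicit Arguments.
Unset Strict Implicit.
Unset Printing Implicit Defensive.
Import Order.TTheory GRing.Theory Num.Theory.
Local Open Scope ring_scope.

Record sgraph := SGraph {
  vertex :> finType;
  adj : rel vertex;
  adj_sym : symmetric adj;
  adj_irr : irreflexive adj
}.

Definition graph_iso (G H : sgraph) : Prop :=
  exists2 f : G -> H, bijective f & forall x y, adj (f x) (f y) = adj x y.

Definition deg (G : sgraph) (v : G) : nat := #|[set u | adj v u]|.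

Definition edges (G : sgraph) : {set {set G}} :=
  [set e : {set G} | [exists x : G, exists y : G,
                       adj x y && (e == [set x; y])]].

Definition is_connected (G : sgraph) : Prop :=
  (0 < #|G|)%N /\ forall x y : G, connect (@adj G) x y.

Definition is_tree (G : sgraph) : Prop :=
  is_connected G /\
  ~ exists c : seq G, (3 <= size c)%N /\ ucycle (@adj G) c.

(* The least length of a walk from x to y; the default value #|G| is only
   reached when y is not reachable from x. *)
Definition gdist (G : sgraph) (x y : G) : nat :=
  \big[minn/#|G|]_(k < #|G| |
    [exists p : k.-tuple G, path (@adj G) x p && (last x p == y)]) k.

Definition diameter (G : sgraph) : nat :=
  \max_(x : G) \max_(y : G) gdist x y.

Definition tree_family (n d : nat) (G : sgraph) : Prop :=
  [/\ is_tree G, #|G| = n & diameter G = d].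

(* The path vertex v_(i+1) is inl i; the leaves at v_1 are the inr (inl _) and
   the leaves at v_(d-1) are the inr (inr _). *)
Section DoubleBroom.
Variables l r d : nat.

Definition broom_vertex : finType := ('I_d.-1 + ('I_l + 'I_r))%type.

Definition broom_adj : rel broom_vertex := fun x y =>
  match x, y with
  | inl i, inl j => (j == i.+1 :> nat) || (i == j.+1 :> nat)
  | inl i, inr (inl _) | inr (inl _), inl i => i == 0%N :> nat
  | inl i, inr (inr _) | inr (inr _), inl i => i == d.-2 :> nat
  | inr _, inr _ => false
  end.

Lemma broom_adj_sym : symmetric broom_adj.
Proof. by case=> [i|[i|i]] [j|[j|j]] //=; rewrite orbC. Qed.

Lemma broom_adj_irr : irreflexive broom_adj.
Proof. by case=> [i|[i|i]] //=; rewrite orbb; apply/eqP => /n_Sn. Qed.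

Definition double_broom : sgraph := SGraph broom_adj_sym broom_adj_irr.
End DoubleBroom.

Definition balanced_double_broom (n d : nat) : sgraph :=
  double_broom (uphalf (n - d + 1)) (n - d + 1)./2 d.

Section RandomWalk.
Variables (R : realType) (G : sgraph).

Definition step_prob (u v : G) : R :=
  if adj u v then (deg u)%:R^-1 else 0.

Definition stationary (v : G) : R := (deg v)%:R / (2 * #|edges G|)%N%:R.

Definition point_mass (v : G) : G -> R := fun u => (u == v)%:R.

(* A rule c (for "continue") gives, for every finite walk w = x :: p observed
   so far (with x the starting vertex), the conditional probability of taking
   another step: the decision depends on the whole walk and on extra
   randomness. *)
Section StoppingRule.
Variables (sigma : G -> R) (c : seq G -> R).

(* Probability that the walk starts with x :: p and is not stopped before it
   reaches the end of p. *)
Definition walk_prob (x : G) (p : seq G) : R :=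
  sigma x * \prod_(i < size p)
    (c (x :: take i p) * step_prob (nth x (x :: p) i) (nth x p i)).

(* Probability that x :: p is exactly the stopped walk. *)
Definition stop_prob (x : G) (p : seq G) : R :=
  walk_prob x p * (1 - c (x :: p)).

Definition final_prob (v : G) : \bar R :=
  (\sum_(0 <= t <oo)
    (\sum_(x : G) \sum_(p : t.-tuple G | last x p == v) stop_prob x p)%:E)%E.

(* Expectation of the number of steps of a rule that halts almost surely. *)
Definition expected_steps : \bar R :=
  (\sum_(0 <= t <oo)
    (t%:R * \sum_(x : G) \sum_(p : t.-tuple G) stop_prob x p)%:E)%E.

End StoppingRule.

(* If tau is a probability distribution, the condition on the final vertex
   forces the rule to halt almost surely. *)
Definition stopping_rule (sigma tau : G -> R) (c : seq G -> R) : Prop :=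
  (forall w, 0 <= c w <= 1) /\ (forall v, final_prob sigma c v = (tau v)%:E).

Definition access_time (sigma tau : G -> R) : \bar R :=
  ereal_inf [set expected_steps sigma c | c in stopping_rule sigma tau].

Definition mixing_time : \bar R :=
  \big[maxe/-oo%E]_(v : G) access_time (point_mass v) stationary.

End RandomWalk.

(* Main.v *)
Require Import Defs.
From mathcomp Require Import all_boot all_order all_algebra.
From mathcomp Require Import all_classical all_reals all_analysis.
From mathcomp Require Import zify ring lra.
Set Implicit Arguments.
Unset Strict Implicit.
Unset Printing Implicit Defensive.
Import Order.TTheory GRing.Theory Num.Theory.
Local Open Scope ring_scope.

(* Let D(u) be the sum of the distances from u, and S the sum of all D(u).  In a
   tree every vertex x <> k has exactly one neighbour closer to k, so the
   Laplacian of the distance to k is explicit; hence hitting times are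
   H(x, j) = (n - 1) d(x, j) + D(j) - D(x).  The filling rule stops as early as
   the target allows; under it some vertex j is never left, so that its expected
   length is H(u, pi) = max_j (H(u, j) - H(pi, j)), and T_mix is the maximum over
   u, v of T(u, v) = (n - 1) d(u, v) - D(u) - D(v) + S / (n - 1) - 1/2.

   Project all vertices on the path from u to v, and let L_k be the number of
   vertices projected at distance less than k from u.  Bounding d(x, y) through
   the projections gives (n - 1) T(u, v) <= sum_k 2 L_k (n - L_k) - (n - 1)
   (d(u, v) + 1/2), with equality only if every vertex is at distance at most one
   from the path.  For a maximizing pair u and v are leaves, so the extreme levels
   are 1 and n - 1, and the others increase strictly.  Pairing L_k with
   L_(d(u,v) + 1 - k), one has 2 (A (n - A) + B (n - B)) = n^2 - (A + B - n)^2 -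
   (B - A)^2, which is largest when the levels increase by exactly one and are
   centred at n / 2: this is the balanced double broom. *)

(** * Distances in graphs and trees *)

Lemma leq_bigmin (I : eqType) (s : seq I) (P : pred I) (F : I -> nat) a i :
  i \in s -> P i -> (\big[minn/a]_(j <- s | P j) F j <= F i)%N.
Proof.
elim: s => [//|j s IHs]; rewrite in_cons big_cons => /predU1P[<-|si] Pi.
  by rewrite Pi geq_minl.
case: ifP => _; last exact: IHs.
by apply: leq_trans (IHs si Pi); exact: geq_minr.
Qed.

Section Distance.
Variable G : sgraph.
Hypothesis G_conn : is_connected G.
Implicit Types x y z k : G.

(** [gdist] ranges over lengths below [#|G|]; shortening the walk to a simple path brings it into
    that range. *)
Lemma gdist_min {x y} {p : seq G} :
  path (@adj G) x p -> last x p = y -> (gdist x y <= size p)%N.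
Proof.
move=> xp; case/shortenP: xp => q xq uq sqp lq.
apply: leq_trans (_ : size q <= size p)%N; last by apply: uniq_leq_size => //; case/andP: uq.
have qG : (size q < #|G|)%N.
  by move/card_uniqP: uq => /= <-; exact: max_card.
rewrite /gdist; apply: (@leq_bigmin _ _ _ (fun k : 'I_#|G| => k : nat) _ (Ordinal qG)).
  exact: mem_index_enum.
by apply/existsP; exists (in_tuple q); rewrite /= xq lq eqxx.
Qed.

Lemma gdist_path x y :
  exists p : seq G, [/\ path (@adj G) x p, last x p = y & size p = gdist x y].
Proof.
have [_ /(_ x y)/connectP[p0 xp0 ->]] := G_conn; case/shortenP: xp0 => q xq uq _.
have qG : (size q < #|G|)%N by move/card_uniqP: uq => /= <-; exact: max_card.
move: (gdist_min xq erefl); set g := gdist _ _ => leg.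
(* The iterated minimum is its default [#|G|] or is attained; the simple path found above rules out
   the default. *)
have : g = #|G| \/ exists p : g.-tuple G, path (@adj G) x p && (last x p == last x q).
  rewrite /g /gdist.
  elim/big_rec: _ => [|i r /existsP[p Pp] IH]; first by left.
  rewrite /minn; case: ifP => _ //.
  by right; exists p.
case=> [gG|[p /andP[xp /eqP lp]]]; last by exists p; rewrite size_tuple.
by move: leg; rewrite gG leqNgt qG.
Qed.

Lemma gdistxx x : gdist x x = 0%N.
Proof. by apply/eqP; rewrite -leqn0; exact: (@gdist_min x x [::]). Qed.

Lemma gdist_eq0 x y : (gdist x y == 0%N) = (x == y).
Proof.
apply/eqP/eqP => [|->]; last exact: gdistxx.
by case: (gdist_path x y) => -[|? ?] [_ <- <-].
Qed.

Lemma gdist_adj_le x y : adj x y -> (gdist x y <= 1)%N.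
Proof. by move=> xy; apply: (@gdist_min x y [:: y]); rewrite //= xy. Qed.

Lemma gdist_triangle y x z : (gdist x z <= gdist x y + gdist y z)%N.
Proof.
have [p [xp lp <-]] := gdist_path x y; have [q [yq lq <-]] := gdist_path y z.
by rewrite -size_cat; apply: gdist_min; rewrite ?cat_path ?last_cat lp ?xp.
Qed.

Lemma gdistC x y : gdist x y = gdist y x.
Proof.
suff le (a b : G) : (gdist a b <= gdist b a)%N by apply/eqP; rewrite eqn_leq !le.
have [p [bp lp <-]] := gdist_path b a.
rewrite -(size_belast b) -size_rev; apply: gdist_min; last first.
  by case: p lp {bp} => [//|c p] _; rewrite /= rev_cons last_rcons.
rewrite -lp rev_path; apply: sub_path bp => ? ?.
by rewrite adj_sym.
Qed.

Lemma gdist_nbr x y k : adj x y -> (gdist k x <= gdist k y + 1)%N.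
Proof.
move=> xy; apply: leq_trans (gdist_triangle y k x) _.
by rewrite leq_add2l gdistC gdist_adj_le.
Qed.

Lemma gdist_descend k x : k != x ->
  exists2 y, adj x y & gdist k x = (gdist k y).+1.
Proof.
move=> kx; have [[|y p] [xp lp sp]] := gdist_path x k.
  by rewrite -lp /= eqxx in kx.
case/andP: xp => xy yp; exists y => //.
have := gdist_nbr k xy; have := gdist_min yp lp.
by rewrite (gdistC y) -(gdistC x) -sp /=; lia.
Qed.

Lemma gdist_adj x y : adj x y = (gdist x y == 1%N).
Proof.
apply/idP/eqP => [xy|d1].
  apply/eqP; rewrite eqn_leq gdist_adj_le // lt0n gdist_eq0.
  by apply: contraTneq xy => ->; rewrite adj_irr.
have [|z yz] := @gdist_descend x y.
  by rewrite -gdist_eq0 d1.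
by rewrite d1 => -[/esym/eqP]; rewrite gdist_eq0 adj_sym => /eqP ->.
Qed.

(** Certifies an explicit distance formula: the Lipschitz condition bounds [f] by the distance, the
    descent condition bounds the distance by [f]. *)
Lemma gdist_eq k (f : G -> nat) : f k = 0%N ->
  (forall x y, adj x y -> (f x <= (f y).+1)%N) ->
  (forall x, x != k -> exists2 y, adj x y & f x = (f y).+1) ->
  forall x, gdist k x = f x.
Proof.
move=> fk flip fdesc x; apply/eqP; rewrite eqn_leq; apply/andP; split.
  have [N] := ubnP (f x); elim: N x => // N IH x fx.
  have [->|/fdesc[y xy fy]] := eqVneq x k; first by rewrite gdistxx.
  apply: leq_trans (gdist_nbr k xy) _; rewrite addn1 fy ltnS IH //.
  by rewrite -ltnS -fy.
have [N] := ubnP (gdist k x); elim: N x => // N IH x dx.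
have [<-|/gdist_descend[y xy dy]] := eqVneq k x; first by rewrite fk.
apply: leq_trans (flip _ _ xy) _; rewrite dy ltnS IH //.
by rewrite -ltnS -dy.
Qed.

Lemma gdist_diameter x y : (gdist x y <= diameter G)%N.
Proof.
apply: leq_trans (@leq_bigmax _ (fun x => \max_(y : G) gdist x y)%N x).
exact: (@leq_bigmax _ (fun y => gdist x y) y).
Qed.

End Distance.

(** * Bridges and closer neighbours in a tree *)

Section Tree.
Variable G : sgraph.
Hypothesis G_tree : is_tree G.
Implicit Types x y z k : G.
Let G_conn : is_connected G := proj1 G_tree.

Definition cut_edge x y : rel G :=
  fun a b => adj a b && ([set a; b] != [set x; y]).

Lemma cut_edge_sym x y : symmetric (cut_edge x y).
Proof. by move=> a b; rewrite /cut_edge adj_sym finset.setUC. Qed.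

(** A simple path from [x] to [y] avoiding the edge xy has at least two steps, so this edge closes
    it to a cycle. *)
Lemma tree_bridge x y : adj x y -> ~~ connect (cut_edge x y) x y.
Proof.
move=> xy; apply/negP => /connectP[p0 xp0 ly].
case/shortenP: xp0 ly => p xp up _ ly.
apply: (proj2 G_tree); exists (x :: p); split.
  case: p xp up ly => [|a [|b p]] //=.
    by move=> _ _ xy'; rewrite xy' adj_irr in xy.
  by move=> /andP[/andP[_ +] _] _ ay; rewrite -ay eqxx.
rewrite /ucycle up andbT (cycle_path x) /= -ly adj_sym xy /=.
by apply: sub_path xp => a b /andP[].
Qed.


(* A geodesic to k that starts closer to k than x never visits x. *)
Lemma connect_cut_edge k x y z :
  (gdist k z < gdist k x)%N -> connect (cut_edge x y) z k.
Proof.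
have [N] := ubnP (gdist k z); elim: N z => // N IH z zN zx.
have [<-|kz] := eqVneq k z; first exact: connect0.
have [z' zz' dz] := gdist_descend G_conn kz.
apply: connect_trans (connect1 _) (IH z' _ _); last 2 first.
- by rewrite -ltnS -dz.
- by apply: ltn_trans zx; rewrite dz.
rewrite /cut_edge zz' /=; apply/eqP => /setP/(_ x); rewrite !inE eqxx /=.
by case/orP => /eqP xz; move: zx; rewrite xz ?ltnn // dz ltnNge leqnSn.
Qed.

(** At equal distances, geodesics from [x] and from [y] to [k] both avoid the edge xy and together
    bypass this bridge. *)
Lemma gdist_adj_neq k x y : adj x y -> gdist k x != gdist k y.
Proof.
move=> xy; apply/eqP => dxy; have /negP[] := tree_bridge xy.
have [kx|kx] := eqVneq k x.
  move: dxy xy; rewrite kx gdistxx // => /esym/eqP.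
  by rewrite gdist_eq0 // => /eqP ->; rewrite adj_irr.
have ky : k != y by rewrite -(gdist_eq0 G_conn) -dxy gdist_eq0.
have key a b : adj a b -> k != a -> gdist k a = gdist k b ->
    connect (cut_edge a b) a k.
  move=> ab ka dab; have [z az dz] := gdist_descend G_conn ka.
  apply: connect_trans (connect1 _) (connect_cut_edge _ _); last by rewrite dz.
  rewrite /cut_edge az /=; apply/eqP => /setP/(_ b); rewrite !inE eqxx orbT.
  case/orP => /eqP bz; first by rewrite bz adj_irr in ab.
  by move: dab; rewrite dz -bz => /esym/n_Sn.
apply: connect_trans (key x y xy kx dxy) _.
rewrite (sym_connect_sym (cut_edge_sym _ _)) .
by rewrite (_ : cut_edge x y = cut_edge y x) ?key // 1?adj_sym // /cut_edge finset.setUC.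
Qed.

Lemma gdist_adjP k x y : adj x y ->
  gdist k x = (gdist k y).+1 \/ gdist k y = (gdist k x).+1.
Proof.
move=> xy; have := gdist_adj_neq k xy.
have := gdist_nbr G_conn k xy; have := gdist_nbr G_conn (x := y) (y := x) k.
by rewrite adj_sym => /(_ xy); lia.
Qed.

(** Geodesics from [y] and [z] to [k] never visit [x]; going from [x] through [z] and [k] to [y]
    would bypass the bridge xy. *)
Lemma gdist_closer_uniq k x y z : adj x y -> adj x z ->
  gdist k x = (gdist k y).+1 -> gdist k x = (gdist k z).+1 -> y = z.
Proof.
move=> xy xz dy dz; apply/eqP/negPn/negP => yz; have /negP[] := tree_bridge xy.
have zk : connect (cut_edge x y) z k by apply: connect_cut_edge; rewrite dz.
have yk : connect (cut_edge x y) y k by apply: connect_cut_edge; rewrite dy.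
have xz' : cut_edge x y x z.
  rewrite /cut_edge xz; apply/eqP => /setP/(_ z); rewrite !inE eqxx orbT.
  case/esym/orP => /eqP zE; last by rewrite zE eqxx in yz.
  by rewrite zE adj_irr in xz.
apply: connect_trans (connect1 xz') (connect_trans zk _).
by rewrite (sym_connect_sym (cut_edge_sym _ _)).
Qed.

End Tree.

(** * Distance sums and hitting times in a tree *)

Lemma sum_adj_swap (R : pzRingType) (G : sgraph) (g : G -> R) :
  \sum_x \sum_(y | adj x y) g y = \sum_x (deg x)%:R * g x.
Proof.
rewrite (exchange_big_dep predT) //=; apply: eq_bigr => x _.
rewrite /deg -sum1_card natr_sum mulr_suml; apply: eq_big => [y|y _].
  by rewrite inE adj_sym.
by rewrite mul1r.
Qed.

Lemma double_card_edges (G : sgraph) :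
  (2 * #|edges G|)%N = (\sum_(x : G) deg x)%N.
Proof.
transitivity (\sum_(p : G * G | adj p.1 p.2) 1)%N; last first.
  rewrite -(pair_big_dep predT (fun x y => adj x y) (fun _ _ => 1%N)) /=.
  by apply: eq_bigr => x _; rewrite /deg -sum1_card; apply: eq_bigl => y; rewrite inE.
rewrite (partition_big (fun p : G * G => [set p.1; p.2]%SET) [in edges G]) /=; last first.
  move=> [x y] /= xy; rewrite inE; apply/existsP; exists x.
  by apply/existsP; exists y; rewrite xy eqxx.
rewrite mulnC -sum_nat_const; apply: eq_bigr => e.
rewrite inE => /existsP[x /existsP[y /andP[xy /eqP ->]]].
rewrite sum1_card -[LHS](_ : #|[set (x, y); (y, x)]%SET| = _); last first.
  rewrite cards2 xpair_eqE negb_and (_ : x != y) //.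
  by apply: contraTneq xy => ->; rewrite adj_irr.
apply: eq_card => -[a b]; rewrite !inE /= !xpair_eqE.
apply/orP/andP => [[]/andP[/eqP-> /eqP->]|[ab /eqP abE]].
- by rewrite xy eqxx.
- by rewrite adj_sym xy finset.setUC eqxx.
have xa : x \in [set a; b]%SET by rewrite abE !inE eqxx.
have ya : y \in [set a; b]%SET by rewrite abE !inE eqxx orbT.
have nxy : x != y by apply: contraTneq xy => ->; rewrite adj_irr.
move: xa ya nxy; rewrite !inE => /orP[]/eqP-> /orP[]/eqP->; rewrite ?eqxx //.
- by left.
- by right.
Qed.

Section TreeSums.
Variables (R : realType) (G : sgraph).
Hypothesis G_tree : is_tree G.
Implicit Types x y u v k j : G.
Let G_conn : is_connected G := proj1 G_tree.

Definition dsum u : R := \sum_(x : G) (gdist u x)%:R.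

(** All neighbours of [x] are one step farther from [k], save one when [x != k]: the second term
    corrects for it. A general [f] covers distances and their squares. *)
Lemma sum_nbr_gdist (f : nat -> R) k x :
  \sum_(y | adj x y) f (gdist k y) =
  (deg x)%:R * f (gdist k x).+1 +
  (x != k)%:R * (f (gdist k x).-1 - f (gdist k x).+1).
Proof.
have degE : (deg x)%:R = \sum_(y | adj x y) 1 :> R.
  by rewrite sumr_const /deg cardsE.
rewrite degE mulr_suml.
have [->|xk] := eqVneq x k.
  rewrite mul0r addr0; apply: eq_bigr => y ky; rewrite mul1r gdistxx //.
  by move: ky; rewrite gdist_adj // => /eqP ->.
rewrite eq_sym in xk; have [z xz dz] := gdist_descend G_conn xk.
rewrite (bigD1 z) //= [in RHS](bigD1 z) //= dz /= !mul1r.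
rewrite (eq_bigr (fun=> f (gdist k z).+2)); first by ring.
move=> y /andP[xy yz]; congr f.
case: (gdist_adjP G_tree k xy) => [dy|->]; last by rewrite dz.
by rewrite (gdist_closer_uniq G_tree xy xz dy dz) eqxx in yz.
Qed.

Lemma tree_card_gt0 : (0 < #|G|)%N. Proof. by case: G_conn. Qed.

Lemma sum_indicator_neq (c : R) k : \sum_(x : G) (x != k)%:R * c = (#|G|%:R - 1) * c.
Proof.
rewrite -mulr_suml; congr (_ * _).
rewrite (bigD1 k) //= eqxx add0r (eq_bigr (fun=> 1)) => [|x ->//].
by rewrite sumr_const (cardC1 k) -subn1 natrB // tree_card_gt0.
Qed.

(** Summing the neighbour formula for the distance to [k] over all vertices, the distances cancel;
    the degrees and n - 1 corrections of -2 remain. *)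
Lemma sum_deg : \sum_(x : G) (deg x)%:R = 2 * (#|G|%:R - 1) :> R.
Proof.
have /card_gt0P[k _] := tree_card_gt0.
have := sum_adj_swap (fun x => (gdist k x)%:R : R).
under eq_bigr do rewrite (sum_nbr_gdist (fun i => i%:R)).
rewrite big_split /= => E.
have E1 : \sum_(x : G) (deg x)%:R * (gdist k x).+1%:R =
  \sum_(x : G) (deg x)%:R * (gdist k x)%:R + \sum_(x : G) (deg x)%:R :> R.
  by rewrite -big_split /=; apply: eq_bigr => x _; rewrite -natr1; ring.
have E2 : \sum_(x : G) (x != k)%:R * ((gdist k x).-1%:R - (gdist k x).+1%:R)
   = - 2 * (#|G|%:R - 1) :> R.
  rewrite mulrC -(sum_indicator_neq _ k); apply: eq_bigr => x _.
  case: (gdist k x) (gdist_eq0 G_conn k x) => [|t].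
    by rewrite eqxx (eq_sym k) => <-; rewrite !mul0r.
  by rewrite (eq_sym k) => <-; rewrite /= -!natr1; ring.
by move: E; rewrite E1 E2; lra.
Qed.

(** The same summation with squared distances: the squares cancel and the cross terms leave the
    degree-weighted distances. *)
Lemma sum_deg_gdist k :
  \sum_(x : G) (deg x)%:R * (gdist k x)%:R = 2 * dsum k - (#|G|%:R - 1) :> R.
Proof.
have := sum_adj_swap (fun x => (gdist k x)%:R ^+ 2 : R).
under eq_bigr do rewrite (sum_nbr_gdist (fun i => i%:R ^+ 2)).
rewrite big_split /= => E.
have E1 : \sum_(x : G) (deg x)%:R * (gdist k x).+1%:R ^+ 2 =
  \sum_(x : G) (deg x)%:R * (gdist k x)%:R ^+ 2 +
  2 * (\sum_(x : G) (deg x)%:R * (gdist k x)%:R) + \sum_(x : G) (deg x)%:R :> R.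
  rewrite mulr_sumr -!big_split /=; apply: eq_bigr => x _.
  by rewrite -natr1; ring.
have E2 : \sum_(x : G) (x != k)%:R * ((gdist k x).-1%:R ^+ 2 - (gdist k x).+1%:R ^+ 2)
   = - 4 * dsum k :> R.
  rewrite mulr_sumr; apply: eq_bigr => x _.
  case: (gdist k x) (gdist_eq0 G_conn k x) => [|t].
    by rewrite eqxx (eq_sym k) => <-; rewrite mul0r mulr0.
  by rewrite (eq_sym k) => <-; rewrite /= -!natr1; ring.
by move: E; rewrite E1 E2 sum_deg; lra.
Qed.

Lemma sum_nbr_dsum x :
  \sum_(y | adj x y) dsum y = (deg x)%:R * (dsum x + #|G|%:R) - 2 * (#|G|%:R - 1).
Proof.
rewrite exchange_big /=.
under eq_bigr => k _.
  under eq_bigr do rewrite gdistC //.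
  rewrite (sum_nbr_gdist (fun i => i%:R)) (_ : _ * (_ - _) = (k != x)%:R * - 2).
    over.
  rewrite eq_sym; have [->|xk] := eqVneq k x; first by rewrite !mul0r.
  case: (gdist k x) (gdist_eq0 G_conn k x) => [|t _].
    by rewrite eqxx (negbTE xk).
  by rewrite /= -!natr1; ring.
rewrite big_split /= sum_indicator_neq mulrN mulrC; congr (_ - _).
rewrite -mulr_sumr; congr (_ * _).
under eq_bigr do rewrite -natr1 gdistC //.
by rewrite big_split /= sumr_const.
Qed.

(* The expected hitting time of j from x, in closed form. *)
Definition hitting_time j x : R :=
  (#|G|%:R - 1) * (gdist j x)%:R + dsum j - dsum x.

(** One step lowers the hitting time of [j] by one on average, except from [j] itself, where the
    mean return time 2 (n - 1) / deg j is added. *)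
Lemma hitting_time_nbr j x :
  \sum_(y | adj x y) hitting_time j y =
  (deg x)%:R * (hitting_time j x - 1) + (x == j)%:R * (2 * (#|G|%:R - 1)).
Proof.
rewrite sumrB sum_nbr_dsum big_split /= sumr_const -mulr_sumr.
rewrite (sum_nbr_gdist (fun i => i%:R)) (_ : #|(fun y => adj x y)| = deg x); last first.
  by rewrite /deg cardsE.
rewrite -mulr_natl /hitting_time.
have [->|xj] := eqVneq x j; first by rewrite gdistxx //=; ring.
case: (gdist j x) (gdist_eq0 G_conn j x) => [|t _].
  by rewrite eqxx eq_sym (negbTE xj).
by rewrite /= -!natr1; ring.
Qed.

(* From j to x the term of x drops by [gdist j x] while the other n - 1 terms grow
   by at most [gdist j x]; hence n - 2. *)
Lemma dsum_le j x : dsum x <= dsum j + (#|G|%:R - 2) * (gdist j x)%:R.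
Proof.
rewrite /dsum (bigD1 x) //= [X in _ <= X + _](bigD1 x) //= gdistxx // add0r.
apply: le_trans (_ : \sum_(y | y != x) ((gdist j y)%:R + (gdist j x)%:R) <= _).
  apply: ler_sum => y _; rewrite -natrD ler_nat addnC (gdistC G_conn j x).
  exact: (gdist_triangle G_conn).
rewrite big_split /= sumr_const (cardC1 x) -[X in _ + X <= _]mulr_natl.
rewrite -subn1 natrB ?tree_card_gt0 //.
by rewrite le_eqVlt; apply/orP; left; apply/eqP; ring.
Qed.

Lemma hitting_time_ge0 j x : 0 <= hitting_time j x.
Proof.
have := dsum_le j x; have : 0 <= (gdist j x)%:R :> R by [].
by rewrite /hitting_time; nra.
Qed.

(* Twice the Wiener index. *)
Definition wiener2 : R := \sum_(x : G) dsum x.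

(** This is T(u, v) = H(u, v) - H(pi, v), as [sum_stationary_hitting_time] confirms. *)
Definition mixing_excess u v : R :=
  (#|G|%:R - 1) * (gdist u v)%:R - dsum u - dsum v +
  wiener2 / (#|G|%:R - 1) - 2^-1.

Lemma mixing_excessC u v : mixing_excess u v = mixing_excess v u.
Proof. by rewrite /mixing_excess gdistC // [_ - dsum u - _]addrAC. Qed.

Lemma stationaryE x : stationary R x = (deg x)%:R / (2 * (#|G|%:R - 1)).
Proof. by rewrite /stationary double_card_edges natr_sum sum_deg. Qed.

Hypothesis G_gt1 : (1 < #|G|)%N.

Let m_gt0 : 0 < #|G|%:R - 1 :> R.
Proof. by rewrite subr_gt0 ltr1n. Qed.

Lemma sum_stationary : \sum_(x : G) stationary R x = 1.
Proof.
under eq_bigr do rewrite stationaryE.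
by rewrite -mulr_suml sum_deg divff // mulf_neq0 // gt_eqF.
Qed.

Lemma sum_stationary_hitting_time v j :
  hitting_time j v - \sum_(x : G) stationary R x * hitting_time j x =
  mixing_excess v j.
Proof.
have m0 : #|G|%:R - 1 != 0 :> R by rewrite gt_eqF.
have -> : \sum_(x : G) stationary R x * hitting_time j x =
  2 * dsum j - wiener2 / (#|G|%:R - 1) + 2^-1.
  transitivity ((2 * (#|G|%:R - 1))^-1 *
    ((#|G|%:R - 1) * \sum_(x : G) (deg x)%:R * (gdist j x)%:R +
     dsum j * (\sum_(x : G) (deg x)%:R) -
     \sum_(x : G) (deg x)%:R * dsum x)).
    rewrite !mulr_sumr -big_split -sumrB mulr_sumr; apply: eq_bigr => x _.
    by rewrite stationaryE /hitting_time /=; field.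
  have -> : \sum_(x : G) (deg x)%:R * dsum x = 2 * wiener2 - #|G|%:R * (#|G|%:R - 1).
    under eq_bigr do rewrite mulr_sumr.
    rewrite exchange_big /=.
    under eq_bigr => k _.
      under eq_bigr do rewrite gdistC //.
      rewrite sum_deg_gdist; over.
    by rewrite sumrB sumr_const -mulr_sumr -[X in _ - X = _]mulr_natl.
  by rewrite sum_deg_gdist sum_deg; field.
by rewrite /mixing_excess /hitting_time (gdistC G_conn j v); field.
Qed.

End TreeSums.

(** * Stopped flows and the filling rule *)

Section RealSeries.
Variables (R : realType) (u : nat -> R).
Hypothesis u_ge0 : forall t, 0 <= u t.

Lemma partial_sum_le_nneseries N :
  ((\sum_(0 <= t < N) u t)%:E <= \sum_(0 <= t <oo) (u t)%:E)%E.
Proof.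
rewrite -sumEFin; apply: nneseries_lim_ge => t _ _.
by rewrite lee_fin.
Qed.

Lemma nneseries_le_bound (l : R) :
  (forall N, \sum_(0 <= t < N) u t <= l) ->
  (\sum_(0 <= t <oo) (u t)%:E <= l%:E)%E.
Proof.
move=> ul; apply: lime_le.
  by apply: is_cvg_nneseries => t _ _; rewrite lee_fin.
by apply: nearW => N; rewrite sumEFin lee_fin.
Qed.

End RealSeries.

Section Flow.
Variables (R : realType) (V : finType) (P : V -> V -> R).
Hypothesis P_sum : forall w, \sum_v P w v = 1.
Variables A S : nat -> V -> R.
Hypothesis A_step : forall t v, A t.+1 v = \sum_w (A t w - S t w) * P w v.
Hypothesis S_ge0 : forall t v, 0 <= S t v.
Hypothesis S_le : forall t v, S t v <= A t v.
Hypothesis A0_mass : \sum_v A 0 v = 1.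

(** [A t v] is the mass arriving at [v] at time [t] and [S t v] the part stopped there;
    [flow_mass t] is the probability of not having stopped before time [t]. *)
Definition flow_mass t := \sum_v A t v.
Definition halted t := \sum_v S t v.
Definition halted_at N v := \sum_(0 <= t < N) S t v.

Lemma flow_massS t : flow_mass t.+1 = flow_mass t - halted t.
Proof.
rewrite /flow_mass /halted; under eq_bigr do rewrite A_step.
rewrite exchange_big -sumrB /=; apply: eq_bigr => w _.
by rewrite -mulr_sumr P_sum mulr1.
Qed.

Lemma halted_ge0 t : 0 <= halted t.
Proof. by apply: sumr_ge0. Qed.

Lemma flow_ge0 t v : 0 <= A t v.
Proof. exact: le_trans (S_ge0 t v) (S_le t v). Qed.

Lemma flow_mass_ge0 t : 0 <= flow_mass t.
Proof. by apply: sumr_ge0 => v _; exact: flow_ge0. Qed.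

Lemma flow_mass_le s t : (s <= t)%N -> flow_mass t <= flow_mass s.
Proof.
elim: t => [|t IH]; first by rewrite leqn0 => /eqP ->.
rewrite leq_eqVlt => /predU1P[-> //|]; rewrite ltnS => /IH.
by rewrite flow_massS; have := halted_ge0 t; lra.
Qed.

Lemma flow_mass_halted N : flow_mass N = 1 - \sum_(0 <= t < N) halted t.
Proof.
elim: N => [|N IH]; first by rewrite big_geq // subr0.
by rewrite flow_massS IH big_nat_recr //=; ring.
Qed.

Lemma sum_halted_at N : \sum_v halted_at N v = 1 - flow_mass N.
Proof. by rewrite flow_mass_halted exchange_big /=; ring. Qed.

(** Summation by parts: the mean of the stopping time truncated at [N] is a sum of tail
    probabilities. *)
Lemma halted_time N :
  \sum_(0 <= t < N) t%:R * halted t + N%:R * flow_mass N =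
  \sum_(0 <= t < N) flow_mass t.+1.
Proof.
elim: N => [|N IH]; first by rewrite !big_geq // mul0r addr0.
by rewrite !big_nat_recr //= -IH !flow_massS -natr1; ring.
Qed.

(** Mass stopped between [N] and [M] counts at least [N] steps. Choosing [M] after [N] makes
    [N%:R * flow_mass M] small without control of [N%:R * flow_mass N]. *)
Lemma halted_time_ge N M : (N <= M)%N ->
  \sum_(0 <= t < N) flow_mass t.+1 - N%:R * flow_mass M <=
  \sum_(0 <= t < M) t%:R * halted t.
Proof.
elim: M => [|M IH].
  by rewrite leqn0 => /eqP ->; rewrite !big_geq // mul0r subr0.
rewrite leq_eqVlt => /predU1P[->|]; first by rewrite -halted_time addrK.
rewrite ltnS => NM; have := IH NM; rewrite big_nat_recr //= flow_massS.
have : N%:R * halted M <= M%:R * halted M.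
  by rewrite ler_wpM2r ?halted_ge0 // ler_nat.
by lra.
Qed.

Variable h : V -> R.
Hypothesis h_ge0 : forall v, 0 <= h v.

(** Expected change of [h] plus elapsed time in one step from [w]; it vanishes where [h] behaves as
    a hitting time. *)
Definition drift w := \sum_v P w v * h v - h w + 1.

(** Optional stopping at a finite horizon: potential plus elapsed time changes only through the
    drift of the mass that moves on. *)
Lemma flow_potential N :
  \sum_v A 0 v * h v + \sum_(0 <= t < N) \sum_w (A t w - S t w) * drift w =
  \sum_v A N v * h v + \sum_v halted_at N v * h v +
  \sum_(0 <= t < N) flow_mass t.+1.
Proof.
elim: N => [|N IH].
  rewrite !big_geq // !addr0 [X in _ + X]big1 ?addr0 // => v _.
  by rewrite /halted_at big_geq // mul0r.
rewrite !big_nat_recr //= addrA IH.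
have -> : \sum_v halted_at N.+1 v * h v =
    \sum_v halted_at N v * h v + \sum_v S N v * h v.
  rewrite -big_split /=; apply: eq_bigr => v _.
  by rewrite /halted_at big_nat_recr //= mulrDl.
have -> : \sum_v A N.+1 v * h v =
    \sum_w (A N w - S N w) * \sum_v P w v * h v.
  under eq_bigr do rewrite A_step mulr_suml.
  rewrite exchange_big /=; apply: eq_bigr => w _.
  by rewrite mulr_sumr; apply: eq_bigr => v _; rewrite mulrA.
have -> : \sum_w (A N w - S N w) * drift w =
    \sum_w (A N w - S N w) * (\sum_v P w v * h v) -
    \sum_v A N v * h v + \sum_v S N v * h v + flow_mass N.+1.
  rewrite flow_massS -sumrB -sumrB -!big_split /=; apply: eq_bigr => w _.
  by rewrite /drift; ring.
by ring.
Qed.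

Lemma flow_potential_mass N : \sum_v A N v * h v <= flow_mass N * \sum_v h v.
Proof.
rewrite mulr_suml; apply: ler_sum => v _; apply: ler_wpM2l; first exact: flow_ge0.
by rewrite (bigD1 v) //= lerDl sumr_ge0.
Qed.

Lemma halted_time_mono N M : (N <= M)%N ->
  \sum_(0 <= t < N) t%:R * halted t <= \sum_(0 <= t < M) t%:R * halted t.
Proof.
move=> NM; rewrite [leRHS](big_cat_nat (leq0n N) NM) //= lerDl sumr_ge0 // => t _.
by rewrite mulr_ge0 ?halted_ge0.
Qed.

Section Lower.
Variable tau : V -> R.
Hypothesis tau_sum : \sum_v tau v = 1.
Hypothesis final : forall v, (\sum_(0 <= t <oo) (S t v)%:E = (tau v)%:E)%E.
Hypothesis drift_ge0 : forall w, 0 <= drift w.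

Lemma flow_mass_small (e : R) : 0 < e -> exists N, flow_mass N < e.
Proof.
move=> e0; apply: contrapT => /forallNP large.
have : (\sum_(0 <= t <oo) (halted t)%:E <= (1 - e)%:E)%E.
  apply: nneseries_le_bound => [t|N]; first exact: halted_ge0.
  by have := large N; rewrite flow_mass_halted => /negP; rewrite -leNgt; lra.
rewrite /halted; under eq_eseriesr do rewrite -sumEFin.
rewrite nneseries_sum; last by move=> t v _; rewrite lee_fin.
under eq_bigr do rewrite final.
by rewrite sumEFin tau_sum lee_fin; lra.
Qed.

Lemma halted_time_lower_bound :
  ((\sum_v A 0 v * h v - \sum_v tau v * h v)%:E <=
   \sum_(0 <= t <oo) (t%:R * halted t)%:E)%E.
Proof.
set K := _ - _; set E := (\sum_(0 <= t <oo) _)%E; rewrite leNgt; apply/negP => EK.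
have E_ge M : ((\sum_(0 <= t < M) t%:R * halted t)%:E <= E)%E.
  by apply: partial_sum_le_nneseries => t; rewrite mulr_ge0 ?halted_ge0.
have E0 : (0 <= E)%E by have := E_ge 0; rewrite big_geq.
case: E E0 EK E_ge => [e| |] //; rewrite lee_fin lte_fin => e0 eK E_ge.
pose C := \sum_v h v; have C0 : 0 <= C by apply: sumr_ge0.
have d0 : 0 < (K - e) / 2 by lra.
(* [N] makes the potential of the walking mass less than half the gap [K - e]; [M], chosen for this
   [N], keeps the truncation error within the other half. *)
have [N mN] := flow_mass_small (divr_gt0 d0 (ltr_wpDl C0 ltr01)).
have N1 : 0 < N%:R + 1 :> R by rewrite natr1.
have [M0 mM0] := flow_mass_small (divr_gt0 d0 N1).
pose M := maxn N M0.
have mM : flow_mass M < (K - e) / 2 / (N%:R + 1).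
  by apply: le_lt_trans mM0; apply: flow_mass_le; rewrite leq_maxr.
have NM : N%:R * flow_mass M <= (K - e) / 2.
  rewrite ltr_pdivlMr // in mM; have := flow_mass_ge0 M; lra.
have CN : flow_mass N * C < (K - e) / 2.
  by rewrite ltr_pdivlMr ?ltr_wpDl // in mN; have := flow_mass_ge0 N; lra.
have := E_ge M; rewrite lee_fin; have := halted_time_ge (leq_maxl N M0).
have := flow_potential_mass N; have := flow_potential N.
have : 0 <= \sum_(0 <= t < N) \sum_w (A t w - S t w) * drift w.
  apply: sumr_ge0 => t _; apply: sumr_ge0 => w _.
  by rewrite mulr_ge0 // subr_ge0.
have : \sum_v halted_at N v * h v <= \sum_v tau v * h v.
  apply: ler_sum => v _; apply: ler_wpM2r => //.
  by rewrite -lee_fin -final; apply: partial_sum_le_nneseries.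
by rewrite -/M -/C /K in CN NM *; lra.
Qed.

End Lower.

Section Upper.
Variable tau : V -> R.
Hypothesis tau_sum : \sum_v tau v = 1.
Hypothesis halted_at_le : forall N v, halted_at N v <= tau v.
Hypothesis no_drift : forall t w, (A t w - S t w) * drift w = 0.

Lemma flow_potential_eq N :
  \sum_v A 0 v * h v =
  \sum_v A N v * h v + \sum_v halted_at N v * h v +
  \sum_(0 <= t < N) flow_mass t.+1.
Proof.
rewrite -flow_potential [X in _ = _ + X]big1 ?addr0 // => t _.
by rewrite big1 // => w _; exact: no_drift.
Qed.

(** Without drift the initial potential bounds the elapsed time, which mass at least [e] walking for
    [N] > [H / e] steps would exceed. *)
Lemma flow_mass_vanish (e : R) : 0 < e -> exists N, flow_mass N < e.
Proof.
move=> e0; pose H := \sum_v A 0 v * h v.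
have H0 : 0 <= H by apply: sumr_ge0 => v _; rewrite mulr_ge0 ?flow_ge0.
pose N := Num.bound (H / e).
have HN : H < N%:R * e by rewrite -ltr_pdivrMr // archi_boundP // divr_ge0 // ltW.
exists N; rewrite ltNge; apply/negP => eN.
have := flow_potential_eq N; rewrite -/H.
have : 0 <= \sum_v A N v * h v by apply: sumr_ge0 => v _; rewrite mulr_ge0 ?flow_ge0.
have : 0 <= \sum_v halted_at N v * h v.
  by apply: sumr_ge0 => v _; rewrite mulr_ge0 // sumr_ge0.
suff : N%:R * e <= \sum_(0 <= t < N) flow_mass t.+1 by lra.
rewrite mulr_natl -[N in e *+ N]subn0 -sumr_const_nat big_nat [leRHS]big_nat.
apply: ler_sum => t /andP[_ tN].
exact: le_trans eN (flow_mass_le _).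
Qed.

(** The deficits [tau v - halted_at N v] are nonnegative and add up to the walking mass, so none
    exceeds it. *)
Lemma halted_at_ge N v : tau v - flow_mass N <= halted_at N v.
Proof.
rewrite lerBlDl -lerBlDr.
have -> : flow_mass N = \sum_v (tau v - halted_at N v).
  by rewrite sumrB sum_halted_at tau_sum; ring.
by rewrite (bigD1 v) //= lerDl sumr_ge0 // => w _; rewrite subr_ge0.
Qed.

Lemma halted_final v : (\sum_(0 <= t <oo) (S t v)%:E = (tau v)%:E)%E.
Proof.
have ge N : ((halted_at N v)%:E <= \sum_(0 <= t <oo) (S t v)%:E)%E.
  exact: partial_sum_le_nneseries.
apply/eqP; rewrite eq_le; apply/andP; split.
  by apply: nneseries_le_bound => // N; exact: halted_at_le.
rewrite leNgt; apply/negP => lt.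
have := ge 0; rewrite /halted_at big_geq //.
case: (limn _) lt ge => [s| |] //; rewrite lte_fin => lt ge _.
have [N mN] := flow_mass_vanish (e := tau v - s) ltac:(lra).
by have := ge N; rewrite lee_fin; have := halted_at_ge N v; lra.
Qed.

Lemma halted_time_upper_bound :
  (\sum_(0 <= t <oo) (t%:R * halted t)%:E <=
   (\sum_v A 0 v * h v - \sum_v tau v * h v)%:E)%E.
Proof.
apply: nneseries_le_bound => [t|N]; first by rewrite mulr_ge0 ?halted_ge0.
set K := _ - _; rewrite leNgt; apply/negP => lt.
set s := \sum_(0 <= t < N) _ in lt.
pose C := \sum_v h v; have C0 : 0 <= C by apply: sumr_ge0.
have [M0 mM0] := @flow_mass_vanish ((s - K) / (C + 1))
  ltac:(by rewrite divr_gt0 ?subr_gt0 // ltr_wpDl).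
pose M := maxn N M0.
have mM : flow_mass M < (s - K) / (C + 1).
  by apply: le_lt_trans mM0; apply: flow_mass_le; rewrite leq_maxr.
rewrite ltr_pdivlMr ?(ltr_wpDl C0 ltr01) // in mM.
have := halted_time_mono (leq_maxl N M0); rewrite -/M -/s.
have := halted_time M; have := flow_potential_eq M.
have : 0 <= \sum_v A M v * h v by apply: sumr_ge0 => v _; rewrite mulr_ge0 ?flow_ge0.
have : \sum_v (tau v - flow_mass M) * h v <= \sum_v halted_at M v * h v.
  by apply: ler_sum => v _; apply: ler_wpM2r => //; exact: halted_at_ge.
have -> : \sum_v (tau v - flow_mass M) * h v = \sum_v tau v * h v - flow_mass M * C.
  by rewrite mulr_sumr -sumrB; apply: eq_bigr => v _; rewrite mulrBl.
have : 0 <= M%:R * flow_mass M by rewrite mulr_ge0 ?flow_mass_ge0.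
by have := flow_mass_ge0 M; move: mM; rewrite /K; lra.
Qed.

End Upper.
End Flow.

(** * The filling rule *)

Section Filling.
Variables (R : realType) (V : finType) (P : V -> V -> R).
Hypothesis P_ge0 : forall w v, 0 <= P w v.
Hypothesis P_sum : forall w, \sum_v P w v = 1.
Variables sigma tau : V -> R.
Hypothesis sigma_ge0 : forall v, 0 <= sigma v.
Hypothesis sigma_sum : \sum_v sigma v = 1.
Hypothesis tau_ge0 : forall v, 0 <= tau v.
Hypothesis tau_sum : \sum_v tau v = 1.

(* The filling rule stops as much mass as the target still allows; the state at
   time t is the arriving mass together with the mass stopped before t. *)
Fixpoint filling t : (V -> R) * (V -> R) :=
  if t is t'.+1 then
    let: (a, f) := filling t' in
    let s v := Num.min (a v) (tau v - f v) in
    (fun v => \sum_w (a w - s w) * P w v, fun v => f v + s v)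
  else (sigma, fun=> 0).

Definition fill_alive t := (filling t).1.
Definition fill_level t := (filling t).2.
Definition fill_halt t v := Num.min (fill_alive t v) (tau v - fill_level t v).

Lemma fill_aliveS t v :
  fill_alive t.+1 v = \sum_w (fill_alive t w - fill_halt t w) * P w v.
Proof. by rewrite /fill_halt /fill_alive /fill_level /=; case: filling. Qed.

Lemma fill_levelS t v : fill_level t.+1 v = fill_level t v + fill_halt t v.
Proof. by rewrite /fill_halt /fill_alive /fill_level /=; case: filling. Qed.

Lemma fill_halt_le t v : fill_halt t v <= fill_alive t v.
Proof. by rewrite ge_min lexx. Qed.

Lemma fill_level_le t v : fill_level t v <= tau v.
Proof.
case: t => [|t]; first exact: tau_ge0.
by rewrite fill_levelS addrC -lerBrDr ge_min lexx orbT.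
Qed.

Lemma fill_halt_ge0 t v : 0 <= fill_halt t v.
Proof.
rewrite le_min subr_ge0 fill_level_le andbT.
elim: t v => [|t IH] v; first exact: sigma_ge0.
rewrite fill_aliveS; apply: sumr_ge0 => w _.
by rewrite mulr_ge0 // subr_ge0 fill_halt_le.
Qed.

Lemma fill_level_sum t v : fill_level t v = halted_at fill_halt t v.
Proof.
rewrite /halted_at; elim: t => [|t IH]; first by rewrite big_geq.
by rewrite fill_levelS IH big_nat_recr.
Qed.

Lemma fill_level_mono s t v : (s <= t)%N -> fill_level s v <= fill_level t v.
Proof.
elim: t => [|t IH]; first by rewrite leqn0 => /eqP ->.
rewrite leq_eqVlt => /predU1P[->//|]; rewrite ltnS => /IH.
by rewrite fill_levelS; have := fill_halt_ge0 t v; lra.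
Qed.

Lemma not_full_halts t v :
  fill_level t.+1 v < tau v -> fill_halt t v = fill_alive t v.
Proof.
rewrite fill_levelS /fill_halt; case: (leP (fill_alive t v)) => //.
by move=> _; rewrite addrCA subrr addr0 ltxx.
Qed.

(* A vertex that is never filled, or one that is filled last, is never left. *)
Lemma filling_halting_state :
  exists j, forall t, fill_halt t j = fill_alive t j.
Proof.
have [[j jP]|full] := pselect (exists j, forall t, fill_level t j < tau j).
  by exists j => t; exact: not_full_halts.
have full_at j : exists t, tau j <= fill_level t j.
  apply: contrapT => /forallNP nf; apply: full; exists j => t.
  by rewrite ltNge; apply/negP/nf.
have {full}full : exists t, [forall j, tau j <= fill_level t j].
  pose T j := sval (cid (full_at j)).
  exists (\max_j T j)%N; apply/forallP => j.
  by apply: le_trans (svalP (cid (full_at j))) (fill_level_mono _ _); exact: leq_bigmax.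
have mass_eq := sum_halted_at P_sum fill_aliveS sigma_sum.
(* [T.+1] is the first time at which all vertices are full; it is not 0, since levels start at zero
   while [tau] has mass 1. *)
case: (ex_minnP full) => -[|T] /forallP fullT minT.
  have : \sum_v tau v <= \sum_v fill_level 0 v by apply: ler_sum => v _; exact: fullT.
  by rewrite tau_sum big1 // ler10.
have : ~~ [forall j, tau j <= fill_level T j].
  by apply/negP => /minT; rewrite ltnn.
rewrite negb_forall => /existsP[j]; rewrite -ltNge => notfull.
exists j => t; have [tT|Tt] := ltnP t T.
  by apply: not_full_halts; apply: le_lt_trans notfull; exact: fill_level_mono.
(* Once all vertices are full the whole mass has stopped, so from time [T] on everything that
   arrives is stopped. *)
have dead : flow_mass fill_alive T.+1 = 0.
  have := mass_eq T.+1; rewrite (eq_bigr tau) ?tau_sum; first by lra.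
  move=> v _; apply/eqP; rewrite -fill_level_sum eq_le fullT.
  by rewrite fill_level_le.
have : flow_mass fill_alive t.+1 <= 0.
  by rewrite -dead; apply: (flow_mass_le P_sum fill_aliveS fill_halt_ge0).
have -> : flow_mass fill_alive t.+1 = \sum_w (fill_alive t w - fill_halt t w).
  by rewrite (flow_massS P_sum fill_aliveS) -sumrB.
have ge0 w : 0 <= fill_alive t w - fill_halt t w by rewrite subr_ge0 fill_halt_le.
rewrite (bigD1 j) //= => le0; apply/eqP; rewrite eq_sym -subr_eq0 eq_le ge0 andbT.
by apply: le_trans le0; rewrite lerDl sumr_ge0.
Qed.

End Filling.

(** * Access times *)

Lemma sum_tuple_rcons (R : nmodType) (T : finType) t (F : seq T -> R) :
  \sum_(q : t.+1.-tuple T) F q = \sum_(p : t.-tuple T) \sum_(a : T) F (rcons p a).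
Proof.
rewrite pair_bigA /=.
rewrite (reindex (fun pa : t.-tuple T * T => [tuple of rcons pa.1 pa.2])) //=.
apply: onW_bij; apply: inj_card_bij; last by rewrite card_prod !card_tuple expnSr.
move=> [p a] [q b] /= /(congr1 val) /= /rcons_inj[pq ->].
by congr (_, _); apply: val_inj.
Qed.

(** * Stopping rules as flows *)

Section WalkFlow.
Variables (R : realType) (G : sgraph) (sigma : G -> R) (c : seq G -> R).

Definition alive_at t v : R :=
  \sum_(x : G) \sum_(p : t.-tuple G | last x p == v) walk_prob sigma c x p.

Definition stop_at t v : R :=
  \sum_(x : G) \sum_(p : t.-tuple G | last x p == v) stop_prob sigma c x p.

Lemma walk_prob_rcons x p v :
  walk_prob sigma c x (rcons p v) =
  walk_prob sigma c x p * c (x :: p) * step_prob R (last x p) v.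
Proof.
rewrite /walk_prob size_rcons big_ord_recr /= -!mulrA; congr (_ * _).
congr (_ * _).
  apply: eq_bigr => i _; rewrite -cats1 take_cat ltn_ord.
  rewrite (nth_cat _ p) ltn_ord; congr (_ * step_prob _ _ _).
  by rewrite -cat_cons nth_cat /= ltnS ltnW.
rewrite -cats1 take_size_cat // nth_cat ltnn subnn /=.
by rewrite -cat_cons nth_cat /= ltnSn (last_nth x).
Qed.

Lemma alive_at0 v : alive_at 0 v = sigma v.
Proof.
rewrite /alive_at (bigD1 v) //= [X in _ + X]big1 ?addr0 => [|x xv].
  rewrite (big_pred1 [tuple]) => [|p]; last by rewrite tuple0 /= !eqxx.
  by rewrite /walk_prob /= big_ord0 mulr1.
by apply: big1 => p; rewrite tuple0 /= (negbTE xv).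
Qed.

(** However much of the past the rule uses, the next step depends only on the endpoint; summing over
    histories gives a flow. *)
Lemma alive_atS t v :
  alive_at t.+1 v =
  \sum_w (alive_at t w - stop_at t w) * step_prob R w v.
Proof.
have -> : \sum_w (alive_at t w - stop_at t w) * step_prob R w v =
    \sum_(x : G) \sum_(p : t.-tuple G) walk_prob sigma c x (rcons p v).
  under eq_bigr => w _.
    rewrite -sumrB mulr_suml.
    under eq_bigr => x _.
      rewrite -sumrB mulr_suml; over.
    over.
  rewrite exchange_big; apply: eq_bigr => x _ /=.
  rewrite (exchange_big_dep predT) //=; apply: eq_bigr => p _.
  rewrite (big_pred1 (last x p)) => [|w]; last by rewrite eq_sym.
  by rewrite walk_prob_rcons /stop_prob mulrBr mulr1 opprB addrCA subrr addr0.
apply: eq_bigr => x _; rewrite big_mkcond.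
rewrite (sum_tuple_rcons _ (fun q => if last x q == v then walk_prob sigma c x q else 0)).
apply: eq_bigr => p _; under eq_bigr do rewrite last_rcons.
by rewrite -big_mkcond big_pred1_eq.
Qed.

Lemma sum_stop_at t :
  \sum_(x : G) \sum_(p : t.-tuple G) stop_prob sigma c x p = halted stop_at t.
Proof.
rewrite /halted /stop_at [RHS]exchange_big; apply: eq_bigr => x _ /=.
rewrite [RHS](exchange_big_dep predT) //=; apply: eq_bigr => p _.
by rewrite (big_pred1 (last x p)) // => w; rewrite eq_sym.
Qed.

Hypothesis sigma_ge0 : forall v, 0 <= sigma v.
Hypothesis c01 : forall w, 0 <= c w <= 1.

Lemma walk_prob_ge0 x p : 0 <= walk_prob sigma c x p.
Proof.
rewrite mulr_ge0 // prodr_ge0 // => i _.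
have /andP[c0 _] := c01 (x :: take i p).
by rewrite mulr_ge0 // /step_prob; case: ifP => // _; rewrite invr_ge0.
Qed.

Lemma stop_at_ge0 t v : 0 <= stop_at t v.
Proof.
apply: sumr_ge0 => x _; apply: sumr_ge0 => p _.
by have /andP[_ c1] := c01 (x :: p); rewrite mulr_ge0 ?walk_prob_ge0 ?subr_ge0.
Qed.

Lemma stop_at_le t v : stop_at t v <= alive_at t v.
Proof.
apply: ler_sum => x _; apply: ler_sum => p _.
have /andP[c0 _] := c01 (x :: p).
by rewrite /stop_prob ler_piMr ?walk_prob_ge0 // gerBl.
Qed.

End WalkFlow.

(** Rules that see only the time and the current vertex suffice to realize the filling rule as a
    stopping rule. *)
Lemma stop_at_markov (R : realType) (G : sgraph) (sigma : G -> R)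
    (g : nat -> G -> R) t v :
  let c w := if w is x :: p then g (size p) (last x p) else 0 in
  stop_at sigma c t v = alive_at sigma c t v * (1 - g t v).
Proof.
rewrite /stop_at /alive_at mulr_suml; apply: eq_bigr => x _.
rewrite mulr_suml; apply: eq_bigr => p /eqP <-.
by rewrite /stop_prob size_tuple.
Qed.

Section AccessTime.
Variables (R : realType) (G : sgraph).
Hypothesis deg_gt0 : forall x : G, (0 < deg x)%N.
Variables sigma tau : G -> R.
Hypothesis sigma_ge0 : forall v, 0 <= sigma v.
Hypothesis sigma_sum : \sum_v sigma v = 1.
Hypothesis tau_ge0 : forall v, 0 <= tau v.
Hypothesis tau_sum : \sum_v tau v = 1.

(* [h j] plays the role of the expected hitting time of j. *)
Variable h : G -> G -> R.
Hypothesis h_ge0 : forall j v, 0 <= h j v.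
Hypothesis h_drift : forall j w, w != j -> drift (step_prob R (G:=G)) (h j) w = 0.
Hypothesis h_drift_ge0 : forall j, 0 <= drift (step_prob R (G:=G)) (h j) j.

Lemma step_prob_ge0 (w v : G) : 0 <= step_prob R w v.
Proof. by rewrite /step_prob; case: ifP => // _; rewrite invr_ge0. Qed.

Lemma sum_step_prob_mul (w : G) (f : G -> R) :
  \sum_v step_prob R w v * f v = (deg w)%:R^-1 * \sum_(v | adj w v) f v.
Proof.
rewrite mulr_sumr [RHS]big_mkcond; apply: eq_bigr => v _.
by rewrite /step_prob; case: ifP => _ //; rewrite mul0r.
Qed.

Lemma sum_step_prob (w : G) : \sum_v step_prob R w v = 1.
Proof.
under eq_bigr do rewrite -[step_prob _ _ _]mulr1.
rewrite sum_step_prob_mul sumr_const (_ : #|(fun v => adj w v)| = deg w); last first.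
  by rewrite /deg cardsE.
by rewrite mulVf // pnatr_eq0 -lt0n.
Qed.

Definition potential_drop j := \sum_v sigma v * h j v - \sum_v tau v * h j v.

Lemma expected_stepsE c :
  expected_steps sigma c =
  (\sum_(0 <= t <oo) (t%:R * halted (stop_at sigma c) t)%:E)%E.
Proof.
by apply: eq_eseriesr => t _; rewrite sum_stop_at.
Qed.

(** With nonnegative drift [h j] drops by at most one per step on average, so each [j] bounds every
    rule from below. *)
Lemma access_time_ge j : ((potential_drop j)%:E <= access_time sigma tau)%E.
Proof.
apply/ereal_infP => _ [c [c01 final] <-]; rewrite expected_stepsE.
have drift_ge0 w : 0 <= drift (step_prob R (G:=G)) (h j) w.
  by have [->//|/h_drift->] := eqVneq w j.
have mass1 : \sum_v alive_at sigma c 0 v = 1.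
  by rewrite -sigma_sum; apply: eq_bigr => v _; rewrite alive_at0.
have := halted_time_lower_bound sum_step_prob (alive_atS sigma c)
  (stop_at_ge0 sigma_ge0 c01) (stop_at_le sigma_ge0 c01) mass1 (h_ge0 j) tau_sum
  final drift_ge0.
by under eq_bigr do rewrite alive_at0.
Qed.

(** The filling rule never leaves some [j], the only vertex where [h j] may have drift, so it meets
    the bound given by this [j]. *)
Lemma access_time_le_filling :
  exists j, (access_time sigma tau <= (potential_drop j)%:E)%E.
Proof.
pose P := step_prob R (G:=G).
pose A := fill_alive P sigma tau; pose S := fill_halt P sigma tau.
have A_S := fill_aliveS P sigma tau.
have S_ge0 := fill_halt_ge0 step_prob_ge0 sigma_ge0 tau_ge0.
have S_le := fill_halt_le P sigma tau.
have [j jP] := filling_halting_state step_prob_ge0 sum_step_prob sigma_ge0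
  sigma_sum tau_ge0 tau_sum.
(* [g] is the fraction of the arriving mass that moves on. Where none arrives the quotient is 0 by
   convention, and there is nothing to stop. *)
exists j; pose g t v := 1 - S t v / A t v.
pose c w := if w is x :: p then g (size p) (last x p) else 0.
have flow_ge0 t v : 0 <= A t v := le_trans (S_ge0 t v) (S_le t v).
have stopE t : (forall v, alive_at sigma c t v = A t v) ->
    forall v, stop_at sigma c t v = S t v.
  move=> aE v; rewrite stop_at_markov -/c aE /g opprB addrCA subrr addr0.
  have [A0|A0] := eqVneq (A t v) 0; last by rewrite mulrC divfK.
  rewrite A0 mul0r; apply/esym/eqP; rewrite eq_le S_ge0 andbT.
  by rewrite -A0 S_le.
have aliveE t v : alive_at sigma c t v = A t v.
  elim: t v => [|t IH] v; first exact: alive_at0.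
  by rewrite alive_atS /A A_S; apply: eq_bigr => w _; rewrite IH stopE.
have {stopE} stopE t v : stop_at sigma c t v = S t v by exact: stopE.
have mass1 : \sum_v A 0 v = 1 by rewrite -sigma_sum.
have level N v : halted_at S N v <= tau v.
  by rewrite /S -fill_level_sum; exact: fill_level_le.
have no_drift t w : (A t w - S t w) * drift P (h j) w = 0.
  have [->|wj] := eqVneq w j; first by rewrite /S jP subrr mul0r.
  by rewrite h_drift // mulr0.
have final v := halted_final sum_step_prob A_S S_ge0 S_le mass1 (h_ge0 j)
  tau_sum level no_drift v.
have time := halted_time_upper_bound sum_step_prob A_S S_ge0 S_le mass1 (h_ge0 j)
  tau_sum level no_drift.
apply: le_trans time; apply: ereal_inf_lbound; exists c.
  split=> [[|x p]|v].
  - by rewrite /c lexx ler01.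
  - rewrite /c /g gerBl divr_ge0 ?S_ge0 // andbT subr_ge0.
    have := flow_ge0 (size p) (last x p); rewrite le_eqVlt => /predU1P[<-|A0].
      by rewrite invr0 mulr0 ler01.
    by rewrite ler_pdivrMr // mul1r S_le.
  - by rewrite /final_prob -final; apply: eq_eseriesr => t _; congr (_%:E); exact: stopE.
rewrite expected_stepsE; apply: eq_eseriesr => t _.
by congr (_ * _)%:E; apply: eq_bigr => v _; exact: stopE.
Qed.

Lemma access_timeP : exists2 j, access_time sigma tau = (potential_drop j)%:E &
  forall i, potential_drop i <= potential_drop j.
Proof.
have [j jP] := access_time_le_filling.
have eqj : access_time sigma tau = (potential_drop j)%:E.
  by apply/eqP; rewrite eq_le jP access_time_ge.
by exists j => // i; rewrite -lee_fin -eqj access_time_ge.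
Qed.

End AccessTime.

(** * Mixing times of trees *)

Section TreeMixing.
Variables (R : realType) (G : sgraph).
Hypothesis G_tree : is_tree G.
Hypothesis G_gt1 : (1 < #|G|)%N.
Let G_conn : is_connected G := proj1 G_tree.

Lemma exists_nbr (x : G) : exists y, adj x y.
Proof.
have /card_gt0P[k] : (0 < #|predC1 x|)%N by rewrite cardC1 -subn1 subn_gt0.
by rewrite inE => kx; have [y xy _] := gdist_descend G_conn kx; exists y.
Qed.

Lemma tree_deg_gt0 (x : G) : (0 < deg x)%N.
Proof. by have [y xy] := exists_nbr x; apply/card_gt0P; exists y; rewrite inE. Qed.

Lemma drift_hitting_time (j w : G) :
  drift (step_prob R (G:=G)) (hitting_time R j) w =
  (w == j)%:R * (2 * (#|G|%:R - 1)) / (deg w)%:R.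
Proof.
rewrite /drift sum_step_prob_mul hitting_time_nbr //.
have dw : (deg w)%:R != 0 :> R by rewrite pnatr_eq0 -lt0n tree_deg_gt0.
by field.
Qed.

Lemma mixing_timeP : exists u v : G,
  mixing_time R G = (mixing_excess R u v)%:E /\
  forall x y : G, mixing_excess R x y <= mixing_excess R u v.
Proof.
have access v : exists2 j, access_time (point_mass R v) (stationary R (G:=G)) =
    (mixing_excess R v j)%:E & forall i, mixing_excess R v i <= mixing_excess R v j.
  have pm_ge0 w : 0 <= point_mass R v w by rewrite /point_mass.
  have pm_sum : \sum_w point_mass R v w = 1.
    rewrite (bigD1 v) //= /point_mass eqxx big1 ?addr0 // => w.
    by move/negbTE=> ->.
  have st_ge0 w : 0 <= stationary R (w : G) by rewrite divr_ge0.
  have drift0 (j w : G) : w != j ->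
      drift (step_prob R (G:=G)) (hitting_time R j) w = 0.
    by move=> /negbTE wj; rewrite drift_hitting_time wj !mul0r.
  have drift_ge0 (j : G) : 0 <= drift (step_prob R (G:=G)) (hitting_time R j) j.
    rewrite drift_hitting_time eqxx mul1r divr_ge0 // mulr_ge0 //.
    by rewrite subr_ge0 ler1n ltnW.
  have dropE i : potential_drop (point_mass R v) (stationary R (G:=G))
      (hitting_time R (G:=G)) i = mixing_excess R v i.
    rewrite -sum_stationary_hitting_time // /potential_drop; congr (_ - _).
    rewrite (bigD1 v) //= /point_mass eqxx mul1r big1 ?addr0 // => w.
    by move/negbTE=> ->; rewrite mul0r.
  have [j -> jmax] := access_timeP tree_deg_gt0 pm_ge0 pm_sum st_ge0
    (sum_stationary R G_tree G_gt1) (hitting_time_ge0 R G_tree) drift0 drift_ge0.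
  exists j; first by rewrite dropE.
  by move=> i; rewrite -!dropE.
have /card_gt0P[x0 _] : (0 < #|G|)%N by exact: ltnW.
case: (@arg_maxP _ R (G * G)%type (x0, x0) predT
  (fun p => mixing_excess R p.1 p.2)) => // -[u v] _ uvmax.
exists u, v; split; last by move=> x y; exact: (uvmax (x, y)).
apply/eqP; rewrite eq_le; apply/andP; split.
  apply: bigmax_le => [|w _]; first by rewrite leNye.
  by have [j -> _] := access w; rewrite lee_fin; exact: (uvmax (w, j)).
apply: le_trans (le_bigmax _ (fun w => access_time (point_mass R w) _) u).
by have [j -> jmax] := access u; rewrite lee_fin.
Qed.

Lemma mixing_time_ge (u v : G) :
  ((mixing_excess R u v)%:E <= mixing_time R G)%E.
Proof. by have [x [y [-> max]]] := mixing_timeP; rewrite lee_fin. Qed.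

(* Moving u away from v lengthens the distance to at most n - 2 vertices. *)
Lemma mixing_excess_extend (u u' v : G) : adj u u' ->
  gdist u' v = (gdist u v).+1 -> mixing_excess R u v < mixing_excess R u' v.
Proof.
move=> uu' d; have := dsum_le R G_tree u u'.
have -> : gdist u u' = 1%N by move: uu'; rewrite gdist_adj // => /eqP.
by rewrite /mixing_excess d -natr1; lra.
Qed.

Section Maximizer.
Variables u v : G.
Hypothesis uv_max : forall x y : G, mixing_excess R x y <= mixing_excess R u v.

(** Moving [u] away from [v] would increase the excess, so all neighbours of [u] lie towards [v],
    which makes [u] a leaf. *)
Lemma maximizer_nbr u' : adj u u' -> gdist u v = (gdist u' v).+1.
Proof.
move=> uu'; case: (gdist_adjP G_tree v uu'); rewrite !(gdistC G_conn v) // => d.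
by have := uv_max u' v; rewrite leNgt mixing_excess_extend.
Qed.

End Maximizer.
End TreeMixing.

(** * Projection on a path *)

Lemma sum_ltn_indicator (N a b : nat) :
  (\sum_(0 <= k < N) ((b < k.+1) && (k < a)))%N = (minn N a - b)%N.
Proof.
elim: N => [|N IH]; first by rewrite big_geq // min0n.
by rewrite big_nat_recr //= IH; lia.
Qed.

Section Coordinates.
Variable G : sgraph.
Hypothesis G_tree : is_tree G.
Let G_conn : is_connected G := proj1 G_tree.
Variables u v : G.
Implicit Types w x y z : G.
Let delta := gdist u v.

(* Every vertex x hangs at height [height x] from the vertex of the path from u
   to v at distance [proj_pos x] from u. *)
Definition proj_pos x := ((gdist u x + delta - gdist v x)./2)%N.
Definition height x := ((gdist u x + gdist v x - delta)./2)%N.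

(** Crossing an edge changes both distances by one. This parity makes the halves in [proj_pos] and
    [height] exact. *)
Lemma gdist_parity x : odd (gdist u x + gdist v x) = odd delta.
Proof.
have [N] := ubnP (gdist u x); elim: N x => // N IH x xN.
have [<-|/(gdist_descend G_conn)[y xy dy]] := eqVneq u x.
  by rewrite gdistxx // gdistC.
rewrite -(IH y); last by lia.
by case: (gdist_adjP G_tree v xy) => ->; lia.
Qed.

Lemma gdist_left x : gdist u x = (proj_pos x + height x)%N.
Proof.
have := gdist_parity x; rewrite /proj_pos /height.
have := gdist_triangle G_conn x u v; have := gdist_triangle G_conn u v x.
have := gdist_triangle G_conn v u x; rewrite (gdistC G_conn v u) (gdistC G_conn x v).
by rewrite -/delta; lia.
Qed.

Lemma gdist_right x : (gdist v x + proj_pos x = delta + height x)%N.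
Proof.
have := gdist_parity x; rewrite /proj_pos /height.
have := gdist_triangle G_conn x u v; have := gdist_triangle G_conn u v x.
have := gdist_triangle G_conn v u x; rewrite (gdistC G_conn v u) (gdistC G_conn x v).
by rewrite -/delta; lia.
Qed.

Lemma proj_pos_le x : (proj_pos x <= delta)%N.
Proof.
have := gdist_left x; have := gdist_right x.
by have := gdist_triangle G_conn v u x; rewrite -/delta; lia.
Qed.

(* In a tree, a step away from v can only be followed by steps away from v. *)
Lemma gdist_between x y : adj x y ->
  gdist v y = (gdist v x).+1 -> gdist u x = (gdist u y).+1 ->
  delta = (gdist u x + gdist v x)%N.
Proof.
have [N] := ubnP (gdist u x); elim: N x y => // N IH x y xN xy dv du.
have [uy|/(gdist_descend G_conn)[z yz dz]] := eqVneq u y.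
  by subst y; rewrite du gdistxx // /delta gdistC // dv; lia.
case: (gdist_adjP G_tree v yz) => dvz.
  have xz : x = z by apply: (gdist_closer_uniq (k := v) G_tree _ yz); rewrite // adj_sym.
  by subst z; lia.
by rewrite (IH y z) //; lia.
Qed.

(** The neighbour towards [u] is also closer to [v]: otherwise [gdist_between] would put [x] on the
    path. *)
Lemma height_descend x : (0 < height x)%N ->
  exists y, [/\ adj x y, proj_pos y = proj_pos x & height x = (height y).+1].
Proof.
move=> hx; have := gdist_left x; have := gdist_right x => rx lx.
have ux : u != x by rewrite -(gdist_eq0 G_conn) lx; lia.
have [y xy dy] := gdist_descend G_conn ux; exists y.
have ly := gdist_left y; have ry := gdist_right y.
case: (gdist_adjP G_tree v xy) => dvy; first by split=> //; lia.
by have := gdist_between xy dvy dy; lia.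
Qed.

Lemma path_step w : height w = 0%N -> (proj_pos w < delta)%N ->
  exists y, [/\ adj w y, height y = 0%N & proj_pos y = (proj_pos w).+1].
Proof.
move=> hw pw; have lw := gdist_left w; have rw := gdist_right w.
have vw : v != w by rewrite -(gdist_eq0 G_conn); lia.
have [y wy dy] := gdist_descend G_conn vw; exists y.
have ly := gdist_left y; have ry := gdist_right y.
by case: (gdist_adjP G_tree u wy) => duy; split=> //; lia.
Qed.

Lemma proj_pos_left : proj_pos u = 0%N.
Proof. by have := gdist_left u; rewrite gdistxx //; lia. Qed.

Lemma height_left : height u = 0%N.
Proof. by have := gdist_left u; rewrite gdistxx //; lia. Qed.

Lemma proj_pos_right : proj_pos v = delta.
Proof. by have := gdist_right v; have := gdist_left v; rewrite gdistxx // -/delta; lia. Qed.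

Lemma height_right : height v = 0%N.
Proof. by have := gdist_right v; have := gdist_left v; rewrite gdistxx // -/delta; lia. Qed.

Lemma path_vertex i : (i <= delta)%N ->
  exists w, height w = 0%N /\ proj_pos w = i.
Proof.
elim: i => [|i IH] id.
  by exists u; rewrite height_left proj_pos_left.
have [w [hw pw]] := IH (ltnW id).
have [|y [_ hy py]] := path_step hw; first by rewrite pw.
by exists y; rewrite hy py pw.
Qed.

(** Induction from [v] backwards: the successors on the path agree, and both vertices are the
    neighbour of that successor closer to [u]. *)
Lemma path_vertex_uniq w w' : height w = 0%N -> height w' = 0%N ->
  proj_pos w = proj_pos w' -> w = w'.
Proof.
have [N] := ubnP (gdist v w); elim: N w w' => // N IH w w' wN hw hw' pw.
have lw := gdist_left w; have rw := gdist_right w.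
have lw' := gdist_left w'; have rw' := gdist_right w'.
have [vw|vw] := eqVneq v w.
  have d0 : gdist v w = 0%N by rewrite -vw gdistxx.
  by apply/eqP; rewrite -{1}vw -(gdist_eq0 G_conn); lia.
have pd : (proj_pos w < delta)%N.
  by move: vw; rewrite -(gdist_eq0 G_conn); have := proj_pos_le w; lia.
have [y [wy hy py]] := path_step hw pd.
have [|y' [wy' hy' py']] := path_step hw'; first by rewrite -pw.
have ly := gdist_left y; have ry := gdist_right y.
have yy' : y = y' by apply: IH => //; lia.
subst y'; apply: (gdist_closer_uniq (k := u) (x := y) G_tree); rewrite 1?adj_sym //; lia.
Qed.

Lemma path_gdist w w' : height w = 0%N -> height w' = 0%N ->
  (proj_pos w <= proj_pos w')%N -> (gdist w w' <= proj_pos w' - proj_pos w)%N.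
Proof.
have [N] := ubnP (proj_pos w' - proj_pos w)%N; elim: N w => // N IH w wN hw hw'.
rewrite leq_eqVlt => /predU1P[pw|pw].
  by rewrite (path_vertex_uniq hw hw' pw) gdistxx.
have [|y [wy hy py]] := path_step hw; first exact: leq_trans (proj_pos_le w').
have := IH y; rewrite hy py => /(_ ltac:(lia) erefl hw' pw).
have := gdist_triangle G_conn y w w'; have := gdist_adj_le wy; lia.
Qed.

Definition proj_dist x y := (proj_pos x - proj_pos y + (proj_pos y - proj_pos x))%N.

Lemma foot_exists x :
  exists w, [/\ height w = 0%N, proj_pos w = proj_pos x & (gdist x w <= height x)%N].
Proof.
move hx: (height x) => k; elim: k x hx => [|k IH] x hx.
  by exists x; rewrite hx gdistxx.
have [|y [xy py hy]] := @height_descend x; first by rewrite hx.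
have [|w [hw pw dw]] := IH y; first by lia.
exists w; split=> //; first by rewrite pw.
have := gdist_triangle G_conn y x w; have := gdist_adj_le xy; lia.
Qed.

Lemma gdist_proj x y : (gdist x y <= height x + height y + proj_dist x y)%N.
Proof.
have [w [hw pw dw]] := foot_exists x; have [z [hz pz dz]] := foot_exists y.
have := gdist_triangle G_conn w x y; have := gdist_triangle G_conn z w y.
rewrite (gdistC G_conn z y).
have : (gdist w z <= proj_dist x y)%N.
  rewrite /proj_dist -pw -pz; have [le|/ltnW le] := leqP (proj_pos w) (proj_pos z).
    by have := path_gdist hw hz le; lia.
  by have := path_gdist hz hw le; rewrite gdistC //; lia.
lia.
Qed.

(** The loss in [gdist_proj]; the diagonal, where the bound would be twice the height, is left
    out. *)
Definition slack x y := if x == y then 0%N else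
  (height x + height y + proj_dist x y - gdist x y)%N.

Definition level k := #|[set x | (proj_pos x < k)%N]|.

(** A distance along the path counts the cuts between consecutive positions that it crosses; a cut
    with L vertices on one side separates L (n - L) unordered pairs. *)
Lemma sum_proj_dist :
  (\sum_x \sum_y proj_dist x y = \sum_(0 <= k < delta) 2 * (level k.+1 * (#|G| - level k.+1)))%N.
Proof.
have half : (\sum_x \sum_y (proj_pos x - proj_pos y) =
    \sum_(0 <= k < delta) level k.+1 * (#|G| - level k.+1))%N.
  under eq_bigr => x _ do under eq_bigr => y _ do
    rewrite -{1}(minn_idPr (proj_pos_le x)) -sum_ltn_indicator.
  under eq_bigr => x _ do rewrite exchange_big.
  rewrite exchange_big /=; apply: eq_bigr => k _.
  have levelE : level k.+1 = (\sum_y (proj_pos y < k.+1))%N.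
    by rewrite /level -sum1_card big_mkcond; apply: eq_bigr => y _; rewrite inE; case: ifP.
  have colevelE : (#|G| - level k.+1 = \sum_x (k < proj_pos x))%N.
    rewrite -(cardsC [set x | (proj_pos x < k.+1)%N]) -/(level k.+1) addKn.
    by rewrite -sum1_card big_mkcond; apply: eq_bigr => x _; rewrite !inE -leqNgt; case: ifP.
  rewrite colevelE levelE mulnC big_distrl /=; apply: eq_bigr => x _.
  by rewrite big_distrr; apply: eq_bigr => y _ /=; rewrite mulnb andbC.
rewrite /proj_dist; under eq_bigr do rewrite big_split /=.
rewrite big_split /= [X in (_ + X)%N]exchange_big /= half addnn -mul2n.
by rewrite big_distrr.
Qed.

(** The total height [Q] enters both the distance sums of [u] and [v] and the Wiener index, and
    cancels; cuts, slack and path length survive. *)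
Lemma mixing_excess_level (R : realType) : (1 < #|G|)%N ->
  (#|G|%:R - 1) * mixing_excess R u v =
  (\sum_(0 <= k < delta) 2 * (level k.+1 * (#|G| - level k.+1)))%N%:R
  - (\sum_x \sum_y slack x y)%N%:R
  - (#|G|%:R - 1) * (delta%:R + 2^-1).
Proof.
move=> G1; have m0 : #|G|%:R - 1 != 0 :> R by rewrite gt_eqF // subr_gt0 ltr1n.
pose Q : R := \sum_x (height x)%:R.
have dsumE : dsum R u + dsum R v = #|G|%:R * delta%:R + 2 * Q.
  have -> : #|G|%:R * delta%:R = \sum_(x : G) delta%:R :> R.
    by rewrite sumr_const mulr_natl.
  rewrite /dsum mulr_sumr -!big_split /=.
  apply: eq_bigr => x _; rewrite gdist_left.
  have := gdist_right x => /(congr1 (fun i => i%:R : R)); rewrite !natrD; lra.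
have wE : wiener2 R G + (\sum_x \sum_y slack x y)%N%:R =
   2 * (#|G|%:R - 1) * Q + (\sum_x \sum_y proj_dist x y)%N%:R.
  have offdiag x : \sum_(y | y != x) (height y)%:R = Q - (height x)%:R.
    by rewrite /Q [in RHS](bigD1 x) //=; ring.
  have -> : 2 * (#|G|%:R - 1) * Q =
      \sum_x \sum_(y | y != x) ((height x)%:R + (height y)%:R).
    transitivity (\sum_x ((#|G|%:R - 1) * (height x)%:R + (Q - (height x)%:R))).
      rewrite big_split sumrB /= sumr_const -mulr_sumr -/Q mulrnAl -[Q *+ _]mulr_natl.
      by ring.
    apply: eq_bigr => x _; rewrite big_split /= offdiag sumr_const cardC1.
    by rewrite -subn1 -[_ *+ (_ - 1)]mulr_natl natrB // ltnW.
  rewrite /wiener2 /dsum !natr_sum -!big_split /=; apply: eq_bigr => x _.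
  have pd0 : proj_dist x x = 0%N by rewrite /proj_dist subnn.
  rewrite !natr_sum -big_split /= [LHS](bigD1 x) //=.
  rewrite [X in _ = _ + X](bigD1 x) //= pd0 gdistxx // /slack eqxx !add0r.
  rewrite -big_split; apply: eq_bigr => y yx /=; rewrite eq_sym (negbTE yx).
  by rewrite natrB ?gdist_proj // !natrD; ring.
rewrite -sum_proj_dist.
rewrite /mixing_excess; move: dsumE wE.
set a := dsum R u; set b := dsum R v; set W := wiener2 R G => dsumE wE.
have -> : W = 2 * (#|G|%:R - 1) * Q + (\sum_x \sum_y proj_dist x y)%N%:R
   - (\sum_x \sum_y slack x y)%N%:R by rewrite -wE; ring.
have -> : a = #|G|%:R * delta%:R + 2 * Q - b by rewrite -dsumE; ring.
by rewrite -/delta; field.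
Qed.

End Coordinates.

(** * Optimal levels *)

Lemma sum_sqr_progression (c : int) (k : nat) :
  3 * (\sum_(0 <= j < k) (c - 2 * j%:Z) ^+ 2) =
  3 * k%:Z * c ^+ 2 - 6 * c * k%:Z * (k%:Z - 1) + 2 * (k%:Z - 1) * k%:Z * (2 * k%:Z - 1).
Proof.
elim: k => [|k IH]; first by rewrite big_geq //; ring.
by rewrite big_nat_recr //= mulrDr IH (intS k); ring.
Qed.

Section IncreasingLevels.
Variables (n w : nat) (e : bool) (L : nat -> nat).

(* Twice the loss of the levels j and w - 1 - j against the unconstrained optimum. *)
Definition pair_gap j : int :=
  ((L j)%:Z + (L (w.-1 - j))%:Z - n%:Z) ^+ 2 +
  ((L (w.-1 - j))%:Z - (L j)%:Z) ^+ 2 - e%:Z - (w.-1%:Z - 2 * j%:Z) ^+ 2.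

(** Reversing the sum pairs [j] with [w.-1 - j]; the ideal spreads [w.-1 - 2 * j] then have a closed
    sum of squares. *)
Lemma sum_pair_gap :
  12 * (\sum_(0 <= j < w) (L j)%:Z * (n%:Z - (L j)%:Z)) +
  3 * (\sum_(0 <= j < w) pair_gap j) =
  3 * w%:Z * (n%:Z ^+ 2 - e%:Z) - (w%:Z ^+ 3 - w%:Z).
Proof.
have rev : \sum_(0 <= j < w) (L j)%:Z * (n%:Z - (L j)%:Z) =
    \sum_(0 <= j < w) (L (w.-1 - j))%:Z * (n%:Z - (L (w.-1 - j))%:Z).
  rewrite big_nat_rev /=; apply: eq_big_nat => j jw.
  by rewrite (_ : 0 + w - j.+1 = w.-1 - j)%N //; lia.
have -> : 12 * (\sum_(0 <= j < w) (L j)%:Z * (n%:Z - (L j)%:Z)) =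
    6 * (\sum_(0 <= j < w) (L j)%:Z * (n%:Z - (L j)%:Z)) +
    6 * (\sum_(0 <= j < w) (L (w.-1 - j))%:Z * (n%:Z - (L (w.-1 - j))%:Z)).
  by rewrite -rev; ring.
rewrite !mulr_sumr -!big_split /=.
transitivity (\sum_(0 <= j < w) (3 * (n%:Z ^+ 2 - e%:Z) - 3 * (w.-1%:Z - 2 * j%:Z) ^+ 2)).
  by apply: eq_big_nat => j _; rewrite /pair_gap; ring.
rewrite sumrB sumr_const_nat subn0 -mulr_sumr sum_sqr_progression -[_ *+ w]mulr_natl (natz w).
case: w => [|k] /=; first by ring.
by rewrite (intS k); ring.
Qed.

Hypothesis L_incr : forall j, (j.+1 < w)%N -> (L j < L j.+1)%N.

Lemma incr_gap i j : (i <= j)%N -> (j < w)%N -> (L i + (j - i) <= L j)%N.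
Proof.
elim: j => [|j IH]; first by rewrite leqn0 => /eqP ->; rewrite subnn addn0.
rewrite leq_eqVlt => /predU1P[->|]; first by rewrite subnn addn0.
by rewrite ltnS => ij jw; have := IH ij (ltnW jw); have := L_incr jw; lia.
Qed.

Hypothesis e_parity : e -> odd (n + w.+1).

(* When n has the parity of w, the sum and the difference of the two levels
   cannot both be optimal. *)
Lemma pair_gap_ge0 j : (j < w)%N -> 0 <= pair_gap j.
Proof.
move=> jw; rewrite /pair_gap.
(* [X] tells how far the pair is off centre, [Y] is its spread and [D] the spread of consecutive
   levels. If [e] holds and [Y = D], then [X] is odd. *)
pose X : int := (L j)%:Z + (L (w.-1 - j))%:Z - n%:Z.
pose Y : int := (L (w.-1 - j))%:Z - (L j)%:Z.
pose D : int := w.-1%:Z - 2 * j%:Z.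
have [DY|DY] : (0 <= D /\ D <= Y) \/ (D <= 0 /\ Y <= D).
- have [le|lt] := leqP j (w.-1 - j); [left|right].
    by have := @incr_gap j (w.-1 - j) le; rewrite /D /Y; lia.
  by have := @incr_gap (w.-1 - j) j (ltnW lt) jw; rewrite /D /Y; lia.
- rewrite -/X -/Y -/D; case: (e) e_parity => [/(_ isT) par|_] /=.
    have [YD|YD] := eqVneq Y D; last by nia.
    suff : X != 0 by rewrite YD; nia.
    by move: YD; rewrite /X /Y /D; lia.
  by nia.
- rewrite -/X -/Y -/D; case: (e) e_parity => [/(_ isT) par|_] /=.
    have [YD|YD] := eqVneq Y D; last by nia.
    suff : X != 0 by rewrite YD; nia.
    by move: YD; rewrite /X /Y /D; lia.
  by nia.
Qed.

End IncreasingLevels.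

(** * Levels along a path with extremal ends *)

Section PathLevels.
Variable G : sgraph.
Hypothesis G_tree : is_tree G.
Hypothesis G_gt2 : (2 < #|G|)%N.
Let G_conn : is_connected G := proj1 G_tree.
Variables u v : G.
Let delta := gdist u v.
Hypothesis u_end : forall x : G, adj u x -> gdist u v = (gdist x v).+1.
Hypothesis v_end : forall x : G, adj v x -> gdist u v = (gdist u x).+1.
Implicit Types x y : G.

(** A geodesic from [u] to [x] starts towards [v], so the projection of [x] is not [u]. *)
Lemma proj_pos_gt0 x : x != u -> (0 < proj_pos u v x)%N.
Proof.
move=> /(gdist_descend G_conn)[y uy dy]; have := u_end uy.
have := gdist_left G_tree u v x; have := gdist_right G_tree u v x.
have := gdist_triangle G_conn y v x; rewrite (gdistC G_conn u x).
by rewrite (gdistC G_conn y v) (gdistC G_conn y x); lia.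
Qed.

Lemma proj_pos_lt x : x != v -> (proj_pos u v x < delta)%N.
Proof.
move=> /(gdist_descend G_conn)[y vy dy]; have := v_end vy.
have := gdist_left G_tree u v x; have := gdist_right G_tree u v x.
have := gdist_triangle G_conn y u x; rewrite (gdistC G_conn v x).
by rewrite (gdistC G_conn y x) /delta; lia.
Qed.

Lemma path_length_ge2 : (2 <= delta)%N.
Proof.
have : (0 < #|~: [set u; v]|)%N.
  rewrite cardsCs finset.setCK cards2 subn_gt0; apply: leq_ltn_trans G_gt2.
  by case: (u != v).
case/card_gt0P => x; rewrite !inE negb_or => /andP[/proj_pos_gt0 + /proj_pos_lt].
by lia.
Qed.

Lemma level_first : level u v 1 = 1%N.
Proof.
rewrite -[RHS](cards1 u) /level; apply: eq_card => x; rewrite !inE.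
have [->|/proj_pos_gt0] := eqVneq x u; first by rewrite proj_pos_left //.
by case: (proj_pos u v x).
Qed.

Lemma level_last : level u v delta = #|G|.-1.
Proof.
rewrite -(cardC1 v) /level; apply: eq_card => x; rewrite !inE.
have [->|/proj_pos_lt -> //] := eqVneq x v.
by rewrite proj_pos_right // ltnn.
Qed.

Lemma levelS k : (k <= delta)%N -> (level u v k < level u v k.+1)%N.
Proof.
move=> kd; have [x [hx px]] := path_vertex G_tree kd.
apply: proper_card; apply/properP; split.
  by apply/fintype.subsetP => y; rewrite !inE => /ltnW.
by exists x; rewrite inE px ?ltnn.
Qed.

(** The levels at 1 and [delta] are forced; those at 2, ..., [delta - 1] are free, whence the shift
    by two. *)
Definition inner_level j := level u v j.+2.
(** True when n and [delta] have the same parity: levels rising by one then miss the centre n / 2 by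
    at least a half. *)
Definition parity_defect := odd (#|G| + delta.-1).
Definition path_gap :=
  \sum_(0 <= j < delta - 2) pair_gap #|G| (delta - 2) parity_defect inner_level j.

Lemma inner_level_incr j : (j.+1 < delta - 2)%N -> (inner_level j < inner_level j.+1)%N.
Proof. by move=> jd; apply: levelS; lia. Qed.

Lemma inner_pair_gap_ge0 j : (j < delta - 2)%N ->
  0 <= pair_gap #|G| (delta - 2) parity_defect inner_level j.
Proof.
apply: pair_gap_ge0; first exact: inner_level_incr.
by rewrite /parity_defect; have := path_length_ge2; lia.
Qed.

Lemma path_gap_ge0 : 0 <= path_gap.
Proof.
rewrite /path_gap big_nat sumr_ge0 // => j /andP[_ jd].
exact: inner_pair_gap_ge0.
Qed.

End PathLevels.

(* The value of (n - 1) T_mix forced by optimal levels along a path of length d. *)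
Definition optimal_excess (R : realType) (n d : nat) : R :=
  4 * (n%:R - 1) +
  (3 * (d%:R - 2) * (n%:R ^+ 2 - (odd (n + d.-1))%:R) - ((d%:R - 2) ^+ 3 - (d%:R - 2))) / 6
  - (n%:R - 1) * (d%:R + 2^-1).

Lemma mixing_excess_gap (R : realType) (G : sgraph) (u v : G) :
  is_tree G -> (2 < #|G|)%N ->
  (forall x : G, adj u x -> gdist u v = (gdist x v).+1) ->
  (forall x : G, adj v x -> gdist u v = (gdist u x).+1) ->
  (#|G|%:R - 1) * mixing_excess R u v =
  optimal_excess R #|G| (gdist u v) - (path_gap u v)%:~R / 2
  - (\sum_x \sum_y slack u v x y)%N%:R.
Proof.
move=> G_tree G2 u_end v_end.
have d2 := path_length_ge2 G_tree G2 u_end v_end.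
rewrite mixing_excess_level //; last exact: ltnW.
(* The two forced levels, 1 and n - 1, contribute 2 (n - 1) each. *)
have levE : (\sum_(0 <= k < gdist u v) 2 * (level u v k.+1 * (#|G| - level u v k.+1)))%N%:R =
    4 * (#|G|%:R - 1) + 2 * (\sum_(0 <= j < gdist u v - 2)
      (inner_level u v j)%:Z * (#|G|%:Z - (inner_level u v j)%:Z))%:~R :> R.
  move: (level_first G_tree G2 u_end) (level_last G_tree G2 v_end).
  have lmax j : (inner_level u v j <= #|G|)%N by exact: max_card.
  move: #|G| G2 lmax => n n2 lmax l1 ld.
  move: d2 ld lmax; rewrite /inner_level; case: (gdist u v) => [|[|k]] // _ ld lmax.
  rewrite subn2 /= big_nat_recl // big_nat_recr //= l1 ld.
  rewrite !natrD (_ : n - n.-1 = 1)%N; last by lia.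
  rewrite muln1 natr_sum rmorph_sum mulr_sumr /= subn1.
  have -> : n.-1%:R = n%:R - 1 :> R by rewrite -subn1 natrB // ltnW // ltnW.
  rewrite (eq_bigr (fun j => 2 * ((level u v j.+2)%:Z * (n%:Z - (level u v j.+2)%:Z))%:~R)).
    by ring.
  move=> j _; rewrite !natrM natrB ?lmax //.
  by rewrite rmorphM rmorphB.
have := sum_pair_gap #|G| (gdist u v - 2) (parity_defect u v) (inner_level u v).
rewrite -/(path_gap u v) => /(congr1 (fun z : int => z%:~R : R)).
rewrite levE !(rmorphD, rmorphN, rmorphM, rmorphXn) /= -!pmulrn natrB //.
rewrite /optimal_excess -/(parity_defect u v).
set X := (\sum_(0 <= j < _) _)%:~R; set Y := (path_gap u v)%:~R.
set n := #|G|%:R; set d := (gdist u v)%:R; set e := (nat_of_bool _)%:R.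
set s := (\sum_x \sum_y slack u v x y)%:R.
by lra.
Qed.

(** Longer paths allow a larger optimum; this is why only a diametral pair can attain the bound. *)
Lemma optimal_excess_mono (R : realType) (n a d : nat) :
  (2 <= a)%N -> (a < d)%N -> (d < n)%N ->
  optimal_excess R n a < optimal_excess R n d.
Proof.
move=> a2 ad dn; rewrite /optimal_excess.
have e1 (b : bool) : 0 <= (nat_of_bool b)%:R <= (1 : R) by case: b; rewrite /= lexx ler01.
set ea : R := (nat_of_bool (odd (n + a.-1)))%:R.
set ed : R := (nat_of_bool (odd (n + d.-1)))%:R.
have /andP[ea0 ea1] : 0 <= ea <= 1 by exact: e1.
have /andP[ed0 ed1] : 0 <= ed <= 1 by exact: e1.
have : 2 <= a%:R :> R by rewrite ler_nat.
have : a%:R + 1 <= d%:R :> R by rewrite natr1 ler_nat.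
have : d%:R + 1 <= n%:R :> R by rewrite natr1 ler_nat.
clearbody ea ed; move: {a d n a2 ad dn} (a%:R) (d%:R) (n%:R) => a d n dn ad a2.
(* In these coordinates the constraints read w >= 0, k >= 1, r >= 1. The parity terms are then taken
   at their worst, [ea] as 0 and [ed] as 1. *)
pose w := a - 2; pose k := d - a; pose r := n - d.
have aE : a = w + 2 by rewrite /w; ring.
have dE : d = w + 2 + k by rewrite /w /k; ring.
have nE : n = w + 2 + k + r by rewrite /w /k /r; ring.
have w0 : 0 <= w by rewrite /w; lra.
have k1 : 1 <= k by rewrite /k; lra.
have r1 : 1 <= r by rewrite /r; lra.
move: (w) (k) (r) w0 k1 r1 aE dE nE => {}w {}k {}r w0 k1 r1 -> -> ->.
rewrite -subr_gt0.
suff : 0 < 3 * k * ((w + 2 + k + r) ^+ 2 - 2 * (w + 1 + k + r)) - 3 * (w + k)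
   - ((w + k) ^+ 3 - w ^+ 3 - k).
  have : 0 <= w * ea by rewrite mulr_ge0.
  have : (w + k) * ed <= w + k by rewrite ler_piMr //; lra.
  lra.
have wk : 0 <= w * k by nra.
have wkk : 0 <= w * k * k by nra.
have ks : w + k <= k * (w + k) by nra.
have ksr : 0 <= k * (w + k) * r by nra.
have krr : 0 <= k * (r ^+ 2 + 2 * r + 2) by nra.
have k3 : 0 <= k ^+ 3 by rewrite exprn_ge0 //; lra.
lra.
Qed.

(** * Double brooms *)

(* A vertex of maximal rank on a cycle would have two distinct neighbours of
   smaller rank. *)
Lemma acyclic_of_rank (G : sgraph) (rank : G -> nat) :
  (forall x y z, adj x y -> adj x z ->
     (rank y <= rank x)%N -> (rank z <= rank x)%N -> y = z) ->
  ~ exists c : seq G, (3 <= size c)%N /\ ucycle (@adj G) c.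
Proof.
move=> rankP [c [c3 ucyc]].
have [x0 x0c] : exists x, x \in c.
  by case: c c3 {ucyc} => // x c _; exists x; rewrite mem_head.
have [x xc xmax] := @arg_maxnP G x0 (fun x => x \in c) rank x0c.
have [i p rotc] := rot_to xc.
have mem_rot' y : y \in x :: p -> (rank y <= rank x)%N.
  by rewrite -rotc mem_rot; exact: xmax.
have : ucycle (@adj G) (x :: p) by rewrite -rotc rot_ucycle.
have : (3 <= size (x :: p))%N by rewrite -rotc size_rot.
case: p rotc mem_rot' => // y q _ rank_le; case/lastP: q rank_le => // q z rank_le _.
rewrite /ucycle /= rcons_path => /andP[/andP[xy /andP[_ zx]]].
rewrite last_rcons adj_sym in zx.
have yz : y = z.
  apply: (rankP x) => //; apply: rank_le; first by rewrite !inE eqxx orbT.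
  by rewrite !inE mem_rcons mem_head !orbT.
by rewrite yz mem_rcons mem_head !andbF.
Qed.

Section Broom.
Variables l r d : nat.
Hypothesis l_gt0 : (0 < l)%N.
Hypothesis r_gt0 : (0 < r)%N.
Hypothesis d_ge3 : (3 <= d)%N.

Let B := double_broom l r d.
Implicit Types x y k : B.

Lemma spine_gt0 : (0 < d.-1)%N. Proof. by lia. Qed.
Lemma spine_last : (d.-2 < d.-1)%N. Proof. by lia. Qed.

Definition spine_first : B := inl (Ordinal spine_gt0).
Definition spine_end : B := inl (Ordinal spine_last).
Definition left_leaf : B := inr (inl (Ordinal l_gt0)).
Definition right_leaf : B := inr (inr (Ordinal r_gt0)).

(** Distance from a left leaf along the spine; a leaf takes the position of the spine vertex
    carrying it. *)
Definition broom_pos x : nat :=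
  match x with inl i => i.+1 | inr (inl _) => 1%N | inr (inr _) => d.-1 end.
Definition broom_height x : nat := if x is inl _ then 0%N else 1%N.

Definition broom_dist x y : nat :=
  if x == y then 0%N else
  (broom_height x + broom_height y +
   (broom_pos x - broom_pos y) + (broom_pos y - broom_pos x))%N.

Lemma broom_connected : is_connected B.
Proof.
split; first by apply/card_gt0P; exists spine_first.
have csym := sym_connect_sym (@adj_sym B).
have to_spine x : connect (@adj B) x spine_first.
  have spine (i : 'I_d.-1) : connect (@adj B) (inl i : B) spine_first.
    case: i => i; elim: i => [|i IH] id.
      by rewrite (_ : inl _ = spine_first) ?connect0 //; congr inl; exact: val_inj.
    apply: connect_trans (connect1 _) (IH (ltnW id)).
    by rewrite /= eqxx orbT.
  case: x => [//|[j|j]]; first by apply: connect1.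
  by apply: connect_trans (connect1 _) (spine (Ordinal spine_last)); rewrite /= eqxx.
by move=> x y; apply: connect_trans (to_spine x) _; rewrite csym.
Qed.

Lemma broom_tree : is_tree B.
Proof.
split; first exact: broom_connected.
(* The rank increases along the spine and puts all leaves on top, so a vertex has at most one
   neighbour of no larger rank. *)
apply: (@acyclic_of_rank B (fun x => if x is inl i then i.+1 else d)).
case=> [i|[i|i]] [j|[j|j]] [k|[k|k]] //=; try (have := ltn_ord i; lia);
  by move=> ij ik ? ?; congr inl; apply: val_inj => /=; lia.
Qed.

Lemma gdist_broom x y : gdist x y = broom_dist x y.
Proof.
rewrite gdistC; last exact: broom_connected.
move: x; apply: gdist_eq => //.
- exact: broom_connected.
- by rewrite /broom_dist eqxx.
- rewrite /broom_dist => a b; case: (eqVneq a y) (eqVneq b y) => [->|ay] [->|yb] //.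
  + by move: y a {ay} => [i|[i|i]] [j|[j|j]] //=; have := ltn_ord i; lia.
  + by move: y a b {ay yb} => [i|[i|i]] [j|[j|j]] [k|[k|k]] //=;
      have := ltn_ord i; have := ltn_ord j; lia.
- rewrite /broom_dist => x xy; rewrite (negbTE xy).
  suff [z xz dz] : exists2 z : B, adj x z & (if z == y then 1%N else
      (broom_height z + broom_height y + (broom_pos z - broom_pos y) +
       (broom_pos y - broom_pos z)).+1) = (broom_height x + broom_height y +
       (broom_pos x - broom_pos y) + (broom_pos y - broom_pos x))%N.
    by exists z => //; rewrite -dz; case: ifP.
  move: x y xy => [i|[i|i]] y xy; last 2 first.
  - exists spine_first => //; case: eqVneq => [<-|] /=; first by lia.
    by move: y xy => [k|[k|k]] /=; lia.
  - exists spine_end; rewrite /= ?eqxx //; case: eqVneq => [<-|] /=; first by lia.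
    by move: y xy => [k|[k|k]] /=; have := ltn_ord k; lia.
  have id := ltn_ord i.
  (* The target lies further right, is a leaf hanging at this spine vertex, or lies further left. *)
  have [lt|[eq|gt]] : (i < broom_pos y - 1)%N \/
      (i.+1 = broom_pos y) \/ (broom_pos y < i.+1)%N by lia.
  - have i1 : (i.+1 < d.-1)%N by case: y lt xy => [k|[k|k]] /=; have := ltn_ord k; lia.
    exists (inl (Ordinal i1)); rewrite /= ?eqxx //.
    case: eqVneq => [<-|] /=; first by lia.
    by move=> _; lia.
  - case: y eq xy => [k|[k|k]] /= eq xy.
    + by case/eqP: xy; congr inl; apply: val_inj; case: eq.
    + by exists (inr (inl k)); rewrite /= ?eqxx //; lia.
    + by exists (inr (inr k)); rewrite /= ?eqxx //; lia.
  - have y_gt0 : (0 < broom_pos y)%N by case: y {gt xy} => [k|[k|k]] //=; lia.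
    have i1 : (i.-1 < d.-1)%N by lia.
    exists (inl (Ordinal i1)); first by rewrite /=; lia.
    by case: eqVneq => [yE|_] /=; [rewrite -yE /= in gt y_gt0 *|]; lia.
Qed.

End Broom.

(** * The excess between opposite leaves of a double broom *)

Section BroomExcess.
Variables l r d : nat.
Hypothesis l_gt0 : (0 < l)%N.
Hypothesis r_gt0 : (0 < r)%N.
Hypothesis d_ge3 : (3 <= d)%N.

Let B := double_broom l r d.
Implicit Types x y k : B.
Let u : B := left_leaf r d l_gt0.
Let v : B := right_leaf l d r_gt0.
Let B_tree : is_tree B. Proof. exact: broom_tree. Qed.

Lemma card_broom : #|B| = (d.-1 + (l + r))%N.
Proof. by rewrite !card_sum !card_ord. Qed.

Lemma gdist_broom_leaves : gdist u v = d.
Proof. by rewrite gdist_broom // /broom_dist /=; lia. Qed.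

Lemma broom_diameter : diameter B = d.
Proof.
apply/eqP; rewrite eqn_leq; apply/andP; split; last first.
  by rewrite -{1}gdist_broom_leaves gdist_diameter.
apply/bigmax_leqP => x _; apply/bigmax_leqP => y _.
rewrite gdist_broom // /broom_dist; case: ifP => // _.
by move: x y => [i|[i|i]] [j|[j|j]] /=; have := ltn_ord i; have := ltn_ord j; lia.
Qed.

Lemma broom_family n : n = (d.-1 + (l + r))%N -> tree_family n d B.
Proof. by move=> ->; split; [exact: B_tree|exact: card_broom|exact: broom_diameter]. Qed.

Lemma proj_pos_broom x :
  proj_pos u v x = if x == u then 0%N else if x == v then d else broom_pos x.
Proof.
rewrite /proj_pos gdist_broom_leaves !gdist_broom // /broom_dist.
rewrite (eq_sym u) (eq_sym v); case: eqVneq => [->|_] /=; first by lia.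
case: eqVneq => [->|_] /=; first by lia.
by move: x => [i|[i|i]] /=; have := ltn_ord i; lia.
Qed.

Lemma height_broom x :
  height u v x = if (x == u) || (x == v) then 0%N else broom_height x.
Proof.
rewrite /height gdist_broom_leaves !gdist_broom // /broom_dist.
rewrite (eq_sym u) (eq_sym v); case: eqVneq => [->|_] /=; first by lia.
case: eqVneq => [->|_] /=; first by lia.
by move: x => [i|[i|i]] /=; have := ltn_ord i; lia.
Qed.

Lemma slack_broom x y : slack u v x y = 0%N.
Proof.
rewrite /slack; case: eqVneq => // xy.
rewrite gdist_broom // /broom_dist (negbTE xy) /proj_dist !proj_pos_broom !height_broom.
have [xu|_] := eqVneq x u; have [yu|_] := eqVneq y u.
- by rewrite xu yu eqxx in xy.
- rewrite xu; have [->|_] /= := eqVneq y v; first by lia.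
  by move: y {xy} => [j|[j|j]] /=; lia.
- rewrite yu; have [->|_] /= := eqVneq x v; first by lia.
  by move: x {xy} => [j|[j|j]] /=; lia.
have [xv|_] := eqVneq x v; have [yv|_] := eqVneq y v.
- by rewrite xv yv eqxx in xy.
- by rewrite xv; move: y {xy} => [j|[j|j]] /=; have := ltn_ord j; lia.
- by rewrite yv; move: x {xy} => [j|[j|j]] /=; have := ltn_ord j; lia.
- by rewrite /=; lia.
Qed.

Lemma inner_level_broom j : (j < d - 2)%N -> inner_level u v j = (l + j.+1)%N.
Proof.
move=> jd; rewrite /inner_level /level -sum1_card big_mkcond /=.
under eq_bigr => x _ do rewrite inE.
(* Treating [u] and [v] as ordinary leaves moves them from 0 and [d] to 1 and [d.-1], which no
   threshold from 2 to [d.-1] notices. *)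
transitivity (\sum_(x : B) nat_of_bool (broom_pos x < j.+2))%N.
  apply: eq_bigr => x _; rewrite proj_pos_broom.
  have [->|_] := eqVneq x u; first by [].
  have [->|_] := eqVneq x v; last by case: ifP.
  by rewrite /=; do 2 case: ltnP; lia.
rewrite !big_sumType /= !sum_nat_const !card_ord.
rewrite (_ : (\sum_(i < d.-1) (i.+1 < j.+2)) = j.+1)%N; first by lia.
rewrite -(big_mkord xpredT (fun i => nat_of_bool (i.+1 < j.+2)%N)).
transitivity (\sum_(0 <= i < d.-1) ((0 < i.+1) && (i < j.+1)))%N; first by [].
by rewrite sum_ltn_indicator; lia.
Qed.

Lemma left_leaf_end x : adj u x -> gdist u v = (gdist x v).+1.
Proof.
rewrite gdist_broom_leaves; case: x => [i|//] /= /eqP i0.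
by rewrite gdist_broom // /broom_dist /= i0; lia.
Qed.

Lemma right_leaf_end x : adj v x -> gdist u v = (gdist u x).+1.
Proof.
rewrite gdist_broom_leaves; case: x => [i|//] /= /eqP i0.
by rewrite gdist_broom // /broom_dist /= i0; lia.
Qed.

(** The levels rise by one and each pair is off centre by l - r, which balance makes equal to the
    parity defect; gap and slack vanish. *)
Lemma broom_excess (R : realType) : l = uphalf (l + r) ->
  (#|B|%:R - 1) * mixing_excess R u v = optimal_excess R #|B| d.
Proof.
move=> lE; have B2 : (2 < #|B|)%N by rewrite card_broom; lia.
rewrite mixing_excess_gap //; last 2 first.
- exact: left_leaf_end.
- exact: right_leaf_end.
rewrite gdist_broom_leaves (_ : path_gap u v = 0) ?mul0r; last first.
  rewrite /path_gap gdist_broom_leaves big_nat big1 // => j /andP[_ jd].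
  rewrite /pair_gap !inner_level_broom; [|lia..].
  have -> : ((l + j.+1)%:Z + (l + ((d - 2).-1 - j).+1)%:Z - #|B|%:Z) =
      (parity_defect u v)%:Z.
    rewrite /parity_defect gdist_broom_leaves card_broom; lia.
  have -> : ((l + ((d - 2).-1 - j).+1)%:Z - (l + j.+1)%:Z) = (d - 2).-1%:Z - 2 * j%:Z by lia.
  have -> : (parity_defect u v)%:Z ^+ 2 = (parity_defect u v)%:Z.
    by case: (parity_defect u v); rewrite ?expr1n ?expr0n.
  by ring.
rewrite (_ : \sum_x \sum_y slack u v x y = 0)%N; first by rewrite !subr0.
by rewrite big1 // => x _; rewrite big1 // => y _; exact: slack_broom.
Qed.

End BroomExcess.

(** * Extremal trees *)

(* A connected spanning subgraph of a tree contains all its bridges. *)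
Lemma spanning_hom_iso (H G : sgraph) (f : H -> G) :
  is_connected H -> is_tree G -> bijective f ->
  (forall x y, adj x y -> adj (f x) (f y)) -> graph_iso G H.
Proof.
move=> [_ H_conn] G_tree f_bij f_hom.
have f_inj := bij_inj f_bij; have [g fK gK] := f_bij.
suff adjf x y : adj (f x) (f y) = adj x y.
  by exists g; [exists f | move=> x y; rewrite -adjf !gK].
apply/idP/idP => [fxy|]; last exact: f_hom.
apply: contraTT (H_conn x y) => nxy; apply: contra (tree_bridge G_tree fxy).
move=> /connectP[p xp yE].
suff walk a : path (@adj H) a p ->
  connect (cut_edge (f x) (f y)) (f a) (f (last a p)) by rewrite {2}yE walk.
elim: p a {xp yE} => [|b p IH] a /=; first by rewrite connect0.
case/andP=> ab bp; apply: connect_trans (connect1 _) (IH b bp).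
rewrite /cut_edge f_hom //=; apply: contraNneq nxy => /setP eq_ab.
have := eq_ab (f x); have := eq_ab (f y).
rewrite !inE !eqxx orbT /= !(inj_eq f_inj) => yab xab.
have nxy : x != y by apply: contraTneq fxy => ->; rewrite adj_irr.
case/orP: xab yab nxy => /eqP -> /orP[]/eqP ->; rewrite ?eqxx // => _.
by rewrite adj_sym.
Qed.

Section ExtremalPath.
Variable G : sgraph.
Hypothesis G_tree : is_tree G.
Hypothesis G_gt2 : (2 < #|G|)%N.
Let G_conn : is_connected G := proj1 G_tree.
Variables u v : G.
Hypothesis u_end : forall x : G, adj u x -> gdist u v = (gdist x v).+1.
Hypothesis v_end : forall x : G, adj v x -> gdist u v = (gdist u x).+1.
Hypothesis d_ge3 : (3 <= gdist u v)%N.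
Hypothesis gap0 : path_gap u v = 0.
Let d := gdist u v.

Lemma gap0_first_pair :
  pair_gap #|G| (d - 2) (parity_defect u v) (inner_level u v) 0 = 0.
Proof.
have ge0 i := @inner_pair_gap_ge0 G G_tree G_gt2 u v u_end v_end i.
move: gap0; rewrite /path_gap big_nat -/d => /eqP; rewrite psumr_eq0 => [|i /andP[_]].
  move=> /allP/(_ 0%N); rewrite mem_index_iota => /(_ ltac:(lia))/implyP/(_ ltac:(lia)).
  by move/eqP.
exact: ge0.
Qed.

(** Zero gap in the outermost pair makes its spread minimal; strict increase then squeezes the
    levels in between. *)
Lemma gap0_inner_level j : (j < d - 2)%N ->
  inner_level u v j = (inner_level u v 0 + j)%N.
Proof.
move=> jd.
have incr i k : (i <= k)%N -> (k < d - 2)%N ->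
    (inner_level u v i + (k - i) <= inner_level u v k)%N.
  by apply: incr_gap => k'; exact: (inner_level_incr G_tree).
have := incr 0%N j isT jd.
have := incr j (d - 2).-1 ltac:(lia) ltac:(lia).
have := incr 0%N (d - 2).-1 isT ltac:(lia).
have := gap0_first_pair; rewrite /pair_gap subn0.
have [w1|w1] := eqVneq (d - 2)%N 1%N.
  by move=> *; suff -> : j = 0%N; [rewrite addn0|lia].
set a := inner_level u v 0; set b := inner_level u v (d - 2).-1.
set X : int := (a%:Z + b%:Z - _).
move: (d - 2)%N w1 jd => w w1 jd E ab jb aj.
have Y : b%:Z - a%:Z = w.-1%:Z.
  have e1 : (nat_of_bool (parity_defect u v))%:Z <= 1 by case: parity_defect.
  have [//|Yw] := eqVneq (b%:Z - a%:Z) w.-1%:Z.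
  (* A spread of at least [w] would cost w^2 - (w - 1)^2 > 1, more than the parity allowance, as w
     >= 2. *)
  have Yw' : w%:Z <= b%:Z - a%:Z by lia.
  have w2 : 2 <= w%:Z by lia.
  have w1' : w.-1%:Z = w%:Z - 1 by lia.
  by move: E; rewrite w1'; nia.
by lia.
Qed.

(** The outer pair is off centre by [X] with X^2 equal to the parity defect; the two signs are
    mirror images under exchange of [u] and [v]. *)
Lemma gap0_first_level :
  (2 * inner_level u v 0 + d = #|G| + 3 + parity_defect u v \/
   2 * inner_level u v 0 + d + parity_defect u v = #|G| + 3)%N.
Proof.
have := gap0_first_pair.
rewrite /pair_gap subn0 (@gap0_inner_level (d - 2).-1); last by lia.
set a := inner_level u v 0.
set X : int := (a%:Z + _ - _).
have -> : (a + (d - 2).-1)%:Z - a%:Z = (d - 2).-1%:Z - 2 * 0%:Z by lia.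
case: (parity_defect u v) => /= E.
  have : X = 1 \/ X = -1 by nia.
  by rewrite /X; move: #|G| => n; lia.
have : X = 0 by nia.
by rewrite /X; move: #|G| => n; lia.
Qed.

Hypothesis slack0 : (\sum_x \sum_y slack u v x y = 0)%N.

(** A vertex of height at least 2 is adjacent to its neighbour towards the path, while their
    projection bound is at least 3. *)
Lemma slack0_height x : (height u v x <= 1)%N.
Proof.
rewrite leqNgt; apply/negP => hx.
have [|y [xy py hy]] := @height_descend G G_tree u v x; first exact: ltnW.
have : slack u v x y = 0%N.
  have /eqP := slack0; rewrite sum_nat_eq0 => /forallP/(_ x)/eqP/eqP.
  by rewrite sum_nat_eq0 => /forallP/(_ y)/eqP.
rewrite /slack; case: eqVneq => [xy'|_]; first by rewrite xy' adj_irr in xy.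
move: xy; rewrite gdist_adj // => /eqP ->; rewrite /proj_dist py; lia.
Qed.

(** The bound on [i] sits under the existential so that choice yields a total function [p]; beyond
    [d] any vertex serves. *)
Lemma path_point_exists i : exists p, (i <= d)%N -> height u v p = 0%N /\ proj_pos u v p = i.
Proof.
have [le|lt] := leqP i d; last by exists u.
by have [p pP] := path_vertex G_tree le; exists p.
Qed.

Let p i := sval (cid (path_point_exists i)).

Lemma path_point_height i : (i <= d)%N -> height u v (p i) = 0%N.
Proof. by move=> id; have [] := svalP (cid (path_point_exists i)) id. Qed.

Lemma path_point_pos i : (i <= d)%N -> proj_pos u v (p i) = i.
Proof. by move=> id; have [] := svalP (cid (path_point_exists i)) id. Qed.

Lemma path_point_uniq x i : (i <= d)%N -> height u v x = 0%N -> proj_pos u v x = i -> x = p i.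
Proof.
move=> id hx px; apply: (path_vertex_uniq G_tree hx (path_point_height id)).
by rewrite px path_point_pos.
Qed.

(** [u], alone at position 0, joins the vertices hanging at position 1. *)
Definition left_leaves := [set x | (proj_pos u v x < 2)%N] :\ p 1.
Definition right_leaves := [set x | (d - 2 < proj_pos u v x)%N] :\ p d.-1.

Lemma card_left_leaves : #|left_leaves| = (inner_level u v 0).-1.
Proof.
rewrite /inner_level /level (cardsD1 (p 1) [set x | _]) inE path_point_pos //; lia.
Qed.

Lemma card_right_leaves :
  #|right_leaves| = (#|G| - inner_level u v 0 - d.-2)%N.
Proof.
have := cardsC [set x | (proj_pos u v x < d.-1)%N].
have -> : ~: [set x | (proj_pos u v x < d.-1)%N] = [set x | (d - 2 < proj_pos u v x)%N].
  by apply/setP => x; rewrite !inE; lia.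
rewrite (cardsD1 (p d.-1) [set x | (d - 2 < _)%N]) inE path_point_pos -/right_leaves; last by lia.
have := @gap0_inner_level (d - 3); rewrite /inner_level -/(level u v d.-1).
rewrite (_ : (d - 3).+2 = d.-1)%N; last by lia.
by move=> /(_ ltac:(lia)) ->; lia.
Qed.

Definition broom_map (x : double_broom #|left_leaves| #|right_leaves| d) : G :=
  match x with
  | inl i => p i.+1
  | inr (inl i) => enum_val i
  | inr (inr i) => enum_val i
  end.

Lemma left_leafP x : x \in left_leaves -> (proj_pos u v x < 2)%N /\ x <> p 1.
Proof. by rewrite !inE => /andP[/eqP]. Qed.

Lemma right_leafP x : x \in right_leaves ->
  (d - 2 < proj_pos u v x)%N /\ x <> p d.-1.
Proof. by rewrite !inE => /andP[/eqP]. Qed.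

Lemma broom_map_inj : injective broom_map.
Proof.
have sp (i : 'I_d.-1) : (i.+1 <= d)%N by have := ltn_ord i; lia.
case=> [i|[i|i]] [j|[j|j]] //= E.
- have := path_point_pos (sp i); rewrite E path_point_pos // => -[ij].
  by congr inl; apply: val_inj.
- have [] := left_leafP (enum_valP j); rewrite -E path_point_pos // => i1 [].
  by congr p; lia.
- have [] := right_leafP (enum_valP j); rewrite -E path_point_pos // => i1 [].
  by congr p; have := ltn_ord i; lia.
- have [] := left_leafP (enum_valP i); rewrite E path_point_pos // => i1 [].
  by congr p; lia.
- by rewrite (enum_val_inj E).
- have [] := right_leafP (enum_valP j); rewrite -E => + _.
  by have [+ _] := left_leafP (enum_valP i); lia.
- have [] := right_leafP (enum_valP i); rewrite E path_point_pos // => i1 [].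
  by congr p; have := ltn_ord j; lia.
- have [] := right_leafP (enum_valP i); rewrite E => + _.
  by have [+ _] := left_leafP (enum_valP j); lia.
- by rewrite (enum_val_inj E).
Qed.

Lemma adj_foot x i : (i <= d)%N -> proj_pos u v x = i -> x <> p i -> adj x (p i).
Proof.
move=> id px xp; have [w [hw pw dw]] := foot_exists G_tree u v x.
have wp : w = p i by apply: path_point_uniq; rewrite ?pw.
rewrite gdist_adj // -wp eqn_leq (leq_trans dw (slack0_height x)) /=.
by rewrite lt0n gdist_eq0 // wp; apply/eqP.
Qed.

Lemma broom_map_hom x y : adj x y -> adj (broom_map x) (broom_map y).
Proof.
have step i : (i < d)%N -> adj (p i) (p i.+1).
  move=> id; have [h0 h1] := (path_point_height (ltnW id), path_point_height id).
  have [|z [pz hz zp]] := path_step G_tree h0; first by rewrite path_point_pos // ltnW.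
  by rewrite -(path_point_uniq _ hz (i := i.+1)) // zp path_point_pos // ltnW.
have left (j : 'I_#|left_leaves|) : adj (enum_val j) (p 1).
  have [+ nx] := left_leafP (enum_valP j); move: (enum_val j) nx => z nx.
  rewrite ltnS leq_eqVlt => /predU1P[px|]; first by apply: adj_foot => //; lia.
  rewrite ltnS leqn0 => /eqP px.
  have [->|/(proj_pos_gt0 G_tree G_gt2 u_end)] := eqVneq z u; last by rewrite px.
  have -> : u = p 0 by apply: path_point_uniq => //; [exact: height_left|exact: proj_pos_left].
  by apply: step; lia.
have right (j : 'I_#|right_leaves|) : adj (enum_val j) (p d.-1).
  have [+ nx] := right_leafP (enum_valP j); move: (enum_val j) nx => z nx px.
  have [px'|px'] := eqVneq (proj_pos u v z) d.-1.
    by apply: adj_foot => //; lia.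
  have [->|/(proj_pos_lt G_tree G_gt2 v_end)] := eqVneq z v; last by rewrite -/d; lia.
  have -> : v = p d.-1.+1.
    apply: path_point_uniq; [lia|exact: height_right|].
    by rewrite proj_pos_right // -/d; lia.
  by rewrite adj_sym; apply: step; lia.
case: x y => [i|[i|i]] [j|[j|j]] //=.
- have := ltn_ord i; have := ltn_ord j => jd id /orP[]/eqP ->; last rewrite adj_sym.
    by apply: step; lia.
  by apply: step; lia.
- by move=> /eqP ->; rewrite adj_sym.
- by move=> /eqP ->; rewrite adj_sym (_ : d.-2.+1 = d.-1) //; lia.
- by move=> /eqP ->.
- by move=> /eqP ->; rewrite (_ : d.-2.+1 = d.-1) //; lia.
Qed.

(** A bijection preserving edges is enough: the image of the connected broom must use every bridge
    of the tree. *)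
Lemma extremal_iso :
  graph_iso G (double_broom #|left_leaves| #|right_leaves| d).
Proof.
have level1 := level_first G_tree G_gt2 u_end.
have leveld := level_last G_tree G_gt2 v_end.
have level2 : (1 < inner_level u v 0)%N.
  by rewrite -[X in (X < _)%N]level1; apply: levelS => //; lia.
have leveld' : (inner_level u v 0 + d.-2 < #|G|)%N.
  have := @levelS G G_tree u v d.-1 (leq_pred _).
  have := @gap0_inner_level (d - 3); rewrite /inner_level.
  rewrite (_ : (d - 3).+2 = d.-1)%N; last by lia.
  move=> /(_ ltac:(lia)) ->; rewrite prednK; last by lia.
  by rewrite leveld; lia.
have l_gt0 : (0 < #|left_leaves|)%N by rewrite card_left_leaves; lia.
have r_gt0 : (0 < #|right_leaves|)%N by rewrite card_right_leaves subn_gt0 ltn_subRL.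
apply: (@spanning_hom_iso _ _ broom_map) => //.
- exact: broom_connected.
- apply: inj_card_bij; first exact: broom_map_inj.
  rewrite card_broom card_left_leaves card_right_leaves.
  by move: #|G| leveld' => n; lia.
- exact: broom_map_hom.
Qed.

Lemma extremal_balanced :
  (2 * inner_level u v 0 + d = #|G| + 3 + parity_defect u v)%N ->
  graph_iso G (balanced_double_broom #|G| d).
Proof.
move=> balanced; have := extremal_iso; rewrite card_left_leaves card_right_leaves.
have dn : (d < #|G|)%N.
  have := level_last G_tree G_gt2 v_end; rewrite -/d => ld.
  have : forall j, (j <= d)%N -> (j <= level u v j)%N.
    elim=> // j IH jd; exact: leq_ltn_trans (IH (ltnW jd)) (levelS G_tree (ltnW jd)).
  by move=> /(_ d (leqnn d)); rewrite ld; lia.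
rewrite /balanced_double_broom.
have -> : (inner_level u v 0).-1 = uphalf (#|G| - d + 1).
  by move: balanced; rewrite /parity_defect -/d; move: #|G| dn => n; lia.
suff -> : (#|G| - inner_level u v 0 - d.-2 = (#|G| - d + 1)./2)%N by [].
by move: balanced; rewrite /parity_defect -/d; move: #|G| dn => n; lia.
Qed.

End ExtremalPath.

Lemma proj_pos_swap (G : sgraph) (u v x : G) : is_tree G ->
  proj_pos v u x = (gdist u v - proj_pos u v x)%N.
Proof.
move=> G_tree; have G_conn := proj1 G_tree.
have := gdist_left G_tree u v x; have := gdist_right G_tree u v x.
have := gdist_left G_tree v u x; have := gdist_right G_tree v u x.
by rewrite (gdistC G_conn v u); lia.
Qed.

(** Seen from [v], levels are complements of those seen from [u]; this settles the mirror case of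
    [gap0_first_level]. *)
Lemma inner_level_swap (G : sgraph) (u v : G) : is_tree G -> (3 <= gdist u v)%N ->
  (inner_level v u 0 + inner_level u v (gdist u v - 3) = #|G|)%N.
Proof.
move=> G_tree d3; rewrite /inner_level /level.
rewrite -[RHS](cardsC [set x | (proj_pos u v x < (gdist u v - 3).+2)%N]) addnC.
congr (_ + _)%N; apply: eq_card => x; rewrite !inE proj_pos_swap //.
by have := proj_pos_le G_tree u v x; lia.
Qed.

(** * The maximum and its uniqueness *)

Section Main.
Variables (R : realType) (n d : nat).
Hypothesis d_ge3 : (3 <= d)%N.
Hypothesis d_lt_n : (d + 1 <= n)%N.

Let B := balanced_double_broom n d.

Let m_gt0 : 0 < n%:R - 1 :> R.
Proof. by rewrite subr_gt0 ltr1n; lia. Qed.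

Let l_gt0 : (0 < uphalf (n - d + 1))%N. Proof. by lia. Qed.
Let r_gt0 : (0 < (n - d + 1)./2)%N. Proof. by lia. Qed.

Lemma balanced_family : tree_family n d B.
Proof. by apply: broom_family => //; lia. Qed.

Section Tree.
Variable G : sgraph.
Hypothesis G_family : tree_family n d G.
Let G_tree : is_tree G. Proof. by case: G_family. Qed.
Let G_card : #|G| = n. Proof. by case: G_family. Qed.
Let G_gt2 : (2 < #|G|)%N. Proof. by rewrite G_card; lia. Qed.

Variables u v : G.
Hypothesis uv_max : forall x y : G, mixing_excess R x y <= mixing_excess R u v.

Lemma maximizer_left x : adj u x -> gdist u v = (gdist x v).+1.
Proof. exact: (maximizer_nbr G_tree uv_max). Qed.

Lemma maximizer_right x : adj v x -> gdist u v = (gdist u x).+1.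
Proof.
have vu_max (a b : G) : mixing_excess R a b <= mixing_excess R v u.
  by rewrite (mixing_excessC R G_tree v u).
have G_conn := proj1 G_tree; rewrite (gdistC G_conn u) (gdistC G_conn u).
exact: (maximizer_nbr G_tree vu_max).
Qed.

Lemma maximizer_excess :
  (n%:R - 1) * mixing_excess R u v =
  optimal_excess R n (gdist u v) - (path_gap u v)%:~R / 2
  - (\sum_x \sum_y slack u v x y)%N%:R.
Proof.
rewrite -G_card; apply: mixing_excess_gap => //.
- exact: maximizer_left.
- exact: maximizer_right.
Qed.

Lemma maximizer_gap_ge0 : 0 <= (path_gap u v)%:~R :> R.
Proof.
rewrite ler0z; apply: path_gap_ge0 => //.
- exact: maximizer_left.
- exact: maximizer_right.
Qed.

(** The equality case tracks three losses: a pair that is not diametral, levels that are not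
    optimal, and positive slack. *)
Lemma maximizer_excess_le :
  (n%:R - 1) * mixing_excess R u v <= optimal_excess R n d ?= iff
  [&& gdist u v == d, path_gap u v == 0 & (\sum_x \sum_y slack u v x y == 0)%N].
Proof.
have gap0 := maximizer_gap_ge0.
have slack0 : 0 <= (\sum_x \sum_y slack u v x y)%N%:R :> R by [].
have E := maximizer_excess.
have dle : (gdist u v <= d)%N by case: G_family => _ _ <-; exact: gdist_diameter.
have d2 := path_length_ge2 G_tree G_gt2 maximizer_left maximizer_right.
have [dE|dN] /= := eqVneq (gdist u v) d; last first.
  have lt : optimal_excess R n (gdist u v) < optimal_excess R n d.
    by apply: optimal_excess_mono; lia.
  by split; [|apply/negbTE; rewrite lt_eqF]; lra.
rewrite E dE; split; first by lra.
apply/eqP/andP => [eq|[/eqP-> /eqP->]]; last by rewrite mul0r !subr0.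
have g0 : (path_gap u v)%:~R = 0 :> R by lra.
have s0 : (\sum_x \sum_y slack u v x y)%N%:R = 0 :> R by lra.
by split; [rewrite -(intr_eq0 R) g0 | rewrite -(pnatr_eq0 R) s0].
Qed.

Lemma maximizer_excess_eq :
  (n%:R - 1) * mixing_excess R u v = optimal_excess R n d ->
  [/\ gdist u v = d, path_gap u v = 0 & (\sum_x \sum_y slack u v x y = 0)%N].
Proof.
by move/eqP; rewrite maximizer_excess_le => /and3P[/eqP ? /eqP ? /eqP ?].
Qed.

End Tree.

Lemma mixing_time_le (G : sgraph) : tree_family n d G ->
  (mixing_time R G <= (optimal_excess R n d / (n%:R - 1))%:E)%E.
Proof.
move=> G_family; have [G_tree G_card _] := G_family.
have [|u [v [-> uv_max]]] := mixing_timeP R G_tree; first by rewrite G_card; lia.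
rewrite lee_fin ler_pdivlMr // mulrC.
by rewrite (maximizer_excess_le G_family uv_max).
Qed.

(** The upper bound for all trees applies to the broom, and a pair of opposite leaves attains it. *)
Lemma mixing_time_balanced :
  mixing_time R B = (optimal_excess R n d / (n%:R - 1))%:E.
Proof.
have [B_tree B_card _] := balanced_family.
apply/eqP; rewrite eq_le mixing_time_le; last exact: balanced_family.
have B_gt1 : (1 < #|B|)%N by rewrite B_card; lia.
apply: le_trans (mixing_time_ge R B_tree B_gt1 (left_leaf _ d l_gt0) (right_leaf _ d r_gt0)).
have := broom_excess l_gt0 r_gt0 d_ge3 R; rewrite -/B B_card => E.
rewrite lee_fin ler_pdivrMr // mulrC E //; lia.
Qed.

Lemma mixing_time_eq_iso (G : sgraph) : tree_family n d G ->
  mixing_time R G = mixing_time R B -> graph_iso G B.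
Proof.
move=> G_family; have [G_tree G_card _] := G_family.
have [|u [v [-> uv_max]]] := mixing_timeP R G_tree; first by rewrite G_card; lia.
rewrite mixing_time_balanced => -[E].
have {}E : (n%:R - 1) * mixing_excess R u v = optimal_excess R n d.
  by rewrite E mulrC divfK // gt_eqF.
have vu_max (a b : G) : mixing_excess R a b <= mixing_excess R v u.
  by rewrite (mixing_excessC R G_tree v u).
have G2 : (2 < #|G|)%N by rewrite G_card; lia.
have [dE gap0 slack0] := maximizer_excess_eq G_family uv_max E.
have [dE' gap0' slack0'] := maximizer_excess_eq G_family vu_max
  ltac:(by rewrite (mixing_excessC R G_tree v u)).
have ul := maximizer_left G_family uv_max; have vr := maximizer_right G_family uv_max.
have vl := maximizer_left G_family vu_max; have ur := maximizer_right G_family vu_max.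
rewrite /B -G_card.
have d3 : (3 <= gdist u v)%N by rewrite dE.
have d3' : (3 <= gdist v u)%N by rewrite dE'.
have first_level := gap0_first_level G_tree G2 ul vr d3 gap0.
(* The balanced broom carries its larger bunch of leaves at the first end; if that bunch is at [v],
   the roles of [u] and [v] are exchanged. *)
have [le|gt] := leqP (#|G| + 3 + parity_defect u v)%N (2 * inner_level u v 0 + gdist u v)%N.
  by rewrite -dE; apply: extremal_balanced => //; lia.
rewrite -dE'; apply: extremal_balanced => //.
have := inner_level_swap G_tree d3.
rewrite (gap0_inner_level G_tree G2 ul vr d3 gap0); last by lia.
have -> : parity_defect v u = parity_defect u v by rewrite /parity_defect dE dE'.
by rewrite dE' -dE; move: first_level gt d3; move: (#|G|) (gdist u v) => a b; lia.
Qed.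

End Main.

Theorem theorem1p3 (R : realType) (n d : nat)
    (hd : (3 <= d)%N) (hn : (d + 1 <= n)%N) :
  [/\ tree_family n d (balanced_double_broom n d),
      forall G : sgraph, tree_family n d G ->
        (mixing_time R G <= mixing_time R (balanced_double_broom n d))%E,
      forall G : sgraph, tree_family n d G ->
        mixing_time R G = mixing_time R (balanced_double_broom n d) ->
        graph_iso G (balanced_double_broom n d),
      odd (n - d) ->
        mixing_time R (balanced_double_broom n d) =
        (((d%:R - 2) * n%:R - d%:R + 5) / 2
          - (d%:R ^+ 3 - 6 * d%:R ^+ 2 + 8 * d%:R) / (6 * (n%:R - 1)))%:E
    & ~~ odd (n - d) ->
        mixing_time R (balanced_double_broom n d) =
        (((d%:R - 2) * n%:R - d%:R + 5) / 2
          - (d%:R ^+ 3 - 6 * d%:R ^+ 2 + 11 * d%:R - 6)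
            / (6 * (n%:R - 1)))%:E].
Proof.
have m0 : n%:R - 1 != 0 :> R by rewrite subr_eq0 (eqr_nat R n 1); lia.
split.
- exact: balanced_family.
- by move=> G ?; rewrite mixing_time_balanced // mixing_time_le.
- by move=> G; exact: mixing_time_eq_iso.
(* Both closed forms are [optimal_excess] over n - 1, with parity term 0 for n - d odd and 1 for n -
   d even. *)
- move=> odd_nd; rewrite mixing_time_balanced // /optimal_excess.
  have -> : odd (n + d.-1) = false by lia.
  by rewrite mulr0n subr0; congr (_%:E); field.
- move=> even_nd; rewrite mixing_time_balanced // /optimal_excess.
  have -> : odd (n + d.-1) = true by lia.
  by rewrite mulr1n; congr (_%:E); field.
Qed.
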